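(* Let $p,q\in(0,1)$. For $\mu,\nu\in\mathbb{Z}$ put $a_\mu=a^\mu$ if $\mu\geq 0$ and $a_\mu=(a^* )^{|\mu|}$ if $\mu<0$, and define $b_\nu$ in the same manner (i.e. $b_\nu=b^\nu$ if $\nu\ge 0$ and $b_\nu=(b^* )^{|\nu|}$ if $\nu<0$). Then the elements \[ \left\{a_\mu(1-aa^* )^m(1-bb^* )^n b_\nu\;\middle|\;\mu,\nu\in\mathbb{Z},\ m,n\in\mathbb{N},\ mn=0\right\} \] form a vector space basis of $\mathcal{O}(S^3_{pq})$. Furthermore, $\mathcal{O}(S^3_{pq})$ is faithfully embedded into $C(S^3_{pq})$, i.e. the canonical map $\mathcal{O}(S^3_{pq})\to C(S^3_{pq})$ is injective.
   Context: For $p,q\in(0,1)$, $\mathcal{O}(S^3_{pq})$ is the universal unital $*$-algebra over $\mathbb{C}$ generated by $a$ and $b$ subject to the relations \[ a^*a-q\,aa^*=1-q,\qquad b^*b-p\,bb^*=1-p,\qquad ab=ba,\qquad a^*b=ba^*,\qquad (1-aa^* )(1-bb^* )=0 . \] $C(S^3_{pq})$ is the enveloping $C^*$-algebra of $\mathcal{O}(S^3_{pq})$, i.e. the $C^*$-completion with respect to $\|x\|=\sup_\rho\|\rho(x)\|$, where $\rho$ runs over all unital $*$-representations of $\mathcal{O}(S^3_{pq})$ in bounded operators on Hilbert spaces (after dividing out elements of seminorm zero, if any; the supremum is finite because $\|\rho(a)\|\le 1$ and $\|\rho(b)\|\le 1$ for every such $\rho$). Here $\mathbb{N}=\{0,1,2,\dots\}$,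 and $(\cdot)^0=1$. *)

(* Defs.v *)
From HB Require Import structures.
From mathcomp Require Import all_boot all_order all_algebra.
From mathcomp Require Import generic_quotient complex sesquilinear.
From mathcomp Require Import ring lra.
From mathcomp Require Import all_classical all_reals all_analysis.

Set Implicit Arguments.
Unset Strict Implicit.
Unset Printing Implicit Defensive.

Import Order.TTheory GRing.Theory Num.Theory.
Import numFieldNormedType.Exports.

Local Open Scope classical_set_scope.
Local Open Scope quotient_scope.
Local Open Scope ring_scope.
Local Open Scope complex_scope.

HB.mixin Record isStarAlgebra (R : realType) A & GRing.Algebra R[i] A := {
  star : A -> A;
  starK : involutive star;
  starD : {morph star : x y / x + y};
  starZ : forall (k : R[i]) (x : A), star (k *: x) = Num.conj k *: star x;
  starM : forall x y : A, star (x * y) = star y * star x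
}.

#[short(type="starAlgType")]
HB.structure Definition StarAlgebra (R : realType) :=
  { A of GRing.Algebra R[i] A & isStarAlgebra R A }.

Section StarTheory.
Variables (R : realType) (A : starAlgType R).

Lemma star0 : star 0 = 0 :> A.
Proof. by apply: (addrI (star 0)); rewrite -starD !addr0. Qed.

Lemma starN (x : A) : star (- x) = - star x.
Proof. by apply: (addrI (star x)); rewrite -starD !subrr star0. Qed.

Lemma starB (x y : A) : star (x - y) = star x - star y.
Proof. by rewrite starD starN. Qed.

Lemma star1 : star 1 = 1 :> A.
Proof. by rewrite -[LHS]mul1r -[X in X * _]starK -starM mul1r starK. Qed.

End StarTheory.

(* The regular module R[i]^o is R[i] as an algebra over itself. *)
HB.instance Definition _ (R : realType) :=
  isStarAlgebra.Build R R[i]^o (@conjCK _)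
    (fun x y : R[i] => rmorphD Num.conj x y)
    (fun k x : R[i] => rmorphM Num.conj k x)
    (fun x y : R[i] => etrans (rmorphM Num.conj x y) (mulrC _ _)).

(* A preStarAlg is a carrier with operations satisfying the axioms of a
   nonzero unital *-algebra up to a congruence peq; pquot is the quotient.
   It is used for the algebra given by generators and relations and for the
   completion (Cauchy sequences modulo null sequences). *)
Record preStarAlg (R : realType) := PreStarAlg {
  pcar :> Type;
  peq : pcar -> pcar -> Prop;
  pzero : pcar;
  pone : pcar;
  padd : pcar -> pcar -> pcar;
  popp : pcar -> pcar;
  pmul : pcar -> pcar -> pcar;
  pscale : R[i] -> pcar -> pcar;
  pstar : pcar -> pcar;
  peq_refl : forall x, peq x x;
  peq_sym : forall x y, peq x y -> peq y x;
  peq_trans : forall x y z, peq x y -> peq y z -> peq x z;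
  peq_add : forall x x' y y', peq x x' -> peq y y' ->
    peq (padd x y) (padd x' y');
  peq_opp : forall x x', peq x x' -> peq (popp x) (popp x');
  peq_mul : forall x x' y y', peq x x' -> peq y y' ->
    peq (pmul x y) (pmul x' y');
  peq_scale : forall k x x', peq x x' -> peq (pscale k x) (pscale k x');
  peq_star : forall x x', peq x x' -> peq (pstar x) (pstar x');
  paddA : forall x y z, peq (padd x (padd y z)) (padd (padd x y) z);
  paddC : forall x y, peq (padd x y) (padd y x);
  padd0 : forall x, peq (padd pzero x) x;
  paddN : forall x, peq (padd (popp x) x) pzero;
  pmulA : forall x y z, peq (pmul x (pmul y z)) (pmul (pmul x y) z);
  pmul1l : forall x, peq (pmul pone x) x;
  pmul1r : forall x, peq (pmul x pone) x;
  pmulDl : forall x y z, peq (pmul (padd x y) z) (padd (pmul x z) (pmul y z));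
  pmulDr : forall x y z, peq (pmul x (padd y z)) (padd (pmul x y) (pmul x z));
  pone_neq0 : ~ peq pone pzero;
  pscaleA : forall k l x, peq (pscale k (pscale l x)) (pscale (k * l) x);
  pscale1 : forall x, peq (pscale 1 x) x;
  pscaleDr : forall k x y,
    peq (pscale k (padd x y)) (padd (pscale k x) (pscale k y));
  pscaleDl : forall k l x,
    peq (pscale (k + l) x) (padd (pscale k x) (pscale l x));
  pscaleAl : forall k x y, peq (pscale k (pmul x y)) (pmul (pscale k x) y);
  pscaleAr : forall k x y, peq (pscale k (pmul x y)) (pmul x (pscale k y));
  pstarK : forall x, peq (pstar (pstar x)) x;
  pstarD : forall x y, peq (pstar (padd x y)) (padd (pstar x) (pstar y));
  pstarZ : forall k x, peq (pstar (pscale k x)) (pscale (Num.conj k) (pstar x));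
  pstarM : forall x y, peq (pstar (pmul x y)) (pmul (pstar y) (pstar x))
}.

Section Quotient.
Variables (R : realType) (P : preStarAlg R).

Definition peqb : rel {classic P} := fun x y => `[< peq x y >].

Lemma peqb_equiv : equiv_class_of peqb.
Proof.
split.
- by move=> x; apply/asboolP; exact: peq_refl.
- by move=> x y; apply/idP/idP => /asboolP h; apply/asboolP; exact: peq_sym.
- by move=> y x z /asboolP h /asboolP h'; apply/asboolP; exact: peq_trans h h'.
Qed.

Canonical peqb_equiv_rel := EquivRelPack peqb_equiv.

Definition pquot : Type := {eq_quot peqb_equiv_rel}.

HB.instance Definition _ := Choice.copy pquot {eq_quot peqb_equiv_rel}.

Definition ppi (x : P) : pquot := \pi_({eq_quot peqb_equiv_rel}) (x : {classic P}).

Definition prepr (x : pquot) : P := repr (x : {eq_quot peqb_equiv_rel}).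

Lemma preprK x : ppi (prepr x) = x.
Proof. exact: reprK. Qed.

Lemma ppiP x y : ppi x = ppi y <-> peq x y.
Proof.
rewrite /ppi; split; first by move=> /eqmodP /asboolP.
by move=> h; apply/eqmodP/asboolP.
Qed.

Lemma prepr_pi x : peq (prepr (ppi x)) x.
Proof. by apply/ppiP; rewrite preprK. Qed.

Lemma pquotW (T : pquot -> Prop) : (forall x, T (ppi x)) -> forall x, T x.
Proof. by move=> h x; rewrite -(preprK x). Qed.

Definition qadd x y := ppi (padd (prepr x) (prepr y)).
Definition qopp x := ppi (popp (prepr x)).
Definition qmul x y := ppi (pmul (prepr x) (prepr y)).
Definition qscale k x := ppi (pscale k (prepr x)).
Definition qstar x := ppi (pstar (prepr x)).

Lemma qaddE x y : qadd (ppi x) (ppi y) = ppi (padd x y).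
Proof. by apply/ppiP/peq_add; exact: prepr_pi. Qed.
Lemma qoppE x : qopp (ppi x) = ppi (popp x).
Proof. by apply/ppiP/peq_opp; exact: prepr_pi. Qed.
Lemma qmulE x y : qmul (ppi x) (ppi y) = ppi (pmul x y).
Proof. by apply/ppiP/peq_mul; exact: prepr_pi. Qed.
Lemma qscaleE k x : qscale k (ppi x) = ppi (pscale k x).
Proof. by apply/ppiP/peq_scale; exact: prepr_pi. Qed.
Lemma qstarE x : qstar (ppi x) = ppi (pstar x).
Proof. by apply/ppiP/peq_star; exact: prepr_pi. Qed.

Definition qE := (qaddE, qoppE, qmulE, qscaleE, qstarE).

Lemma qaddA : associative qadd.
Proof. do 3![elim/pquotW => ?]; rewrite !qE; apply/ppiP; exact: paddA. Qed.
Lemma qaddC : commutative qadd.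
Proof. do 2![elim/pquotW => ?]; rewrite !qE; apply/ppiP; exact: paddC. Qed.
Lemma qadd0 : left_id (ppi (pzero P)) qadd.
Proof. elim/pquotW => ?; rewrite !qE; apply/ppiP; exact: padd0. Qed.
Lemma qaddN : left_inverse (ppi (pzero P)) qopp qadd.
Proof. elim/pquotW => ?; rewrite !qE; apply/ppiP; exact: paddN. Qed.

HB.instance Definition _ := GRing.isZmodule.Build pquot qaddA qaddC qadd0 qaddN.

Lemma qmulA : associative qmul.
Proof. do 3![elim/pquotW => ?]; rewrite !qE; apply/ppiP; exact: pmulA. Qed.
Lemma qmul1l : left_id (ppi (pone P)) qmul.
Proof. elim/pquotW => ?; rewrite !qE; apply/ppiP; exact: pmul1l. Qed.
Lemma qmul1r : right_id (ppi (pone P)) qmul.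
Proof. elim/pquotW => ?; rewrite !qE; apply/ppiP; exact: pmul1r. Qed.
Lemma qmulDl : left_distributive qmul qadd.
Proof. do 3![elim/pquotW => ?]; rewrite !qE; apply/ppiP; exact: pmulDl. Qed.
Lemma qmulDr : right_distributive qmul qadd.
Proof. do 3![elim/pquotW => ?]; rewrite !qE; apply/ppiP; exact: pmulDr. Qed.
Lemma qone_neq0 : ppi (pone P) != 0.
Proof. by apply/eqP => /ppiP; exact: pone_neq0. Qed.

HB.instance Definition _ := GRing.Zmodule_isNzRing.Build pquot
  qmulA qmul1l qmul1r qmulDl qmulDr qone_neq0.

Lemma qscaleA k l x : qscale k (qscale l x) = qscale (k * l) x.
Proof. elim/pquotW: x => ?; rewrite !qE; apply/ppiP; exact: pscaleA. Qed.
Lemma qscale1 : left_id 1 qscale.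
Proof. elim/pquotW => ?; rewrite !qE; apply/ppiP; exact: pscale1. Qed.
Lemma qscaleDr : right_distributive qscale +%R.
Proof.
rewrite -[+%R]/qadd => k; do 2![elim/pquotW => ?]; rewrite !qE.
by apply/ppiP; exact: pscaleDr.
Qed.
Lemma qscaleDl x : {morph qscale^~ x : k l / k + l}.
Proof.
elim/pquotW: x => ? k l; rewrite -[RHS]/(qadd _ _) !qE.
by apply/ppiP; exact: pscaleDl.
Qed.

HB.instance Definition _ := GRing.Zmodule_isLmodule.Build R[i] pquot
  qscaleA qscale1 qscaleDr qscaleDl.

Lemma qscaleAl k (x y : pquot) : k *: (x * y) = k *: x * y.
Proof.
rewrite -[LHS]/(qscale _ (qmul _ _)) -[RHS]/(qmul (qscale _ _) _).
by elim/pquotW: x => ?; elim/pquotW: y => ?; rewrite !qE; apply/ppiP; exact: pscaleAl.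
Qed.
HB.instance Definition _ := GRing.Lmodule_isLalgebra.Build R[i] pquot qscaleAl.

Lemma qscaleAr k (x y : pquot) : k *: (x * y) = x * (k *: y).
Proof.
rewrite -[LHS]/(qscale _ (qmul _ _)) -[RHS]/(qmul _ (qscale _ _)).
by elim/pquotW: x => ?; elim/pquotW: y => ?; rewrite !qE; apply/ppiP; exact: pscaleAr.
Qed.
HB.instance Definition _ := GRing.Lalgebra_isAlgebra.Build R[i] pquot qscaleAr.

Lemma qstarK : involutive qstar.
Proof. elim/pquotW => ?; rewrite !qE; apply/ppiP; exact: pstarK. Qed.
Lemma qstarD : {morph qstar : x y / x + y}.
Proof.
rewrite -[+%R]/qadd.
by do 2![elim/pquotW => ?]; rewrite !qE; apply/ppiP; exact: pstarD.
Qed.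
Lemma qstarZ (k : R[i]) (x : pquot) : qstar (k *: x) = Num.conj k *: qstar x.
Proof.
rewrite -[*:%R]/qscale.
by elim/pquotW: x => ?; rewrite !qE; apply/ppiP; exact: pstarZ.
Qed.
Lemma qstarM (x y : pquot) : qstar (x * y) = qstar y * qstar x.
Proof.
rewrite -[*%R]/qmul.
by elim/pquotW: x => ?; elim/pquotW: y => ?; rewrite !qE; apply/ppiP; exact: pstarM.
Qed.
HB.instance Definition _ := isStarAlgebra.Build R pquot qstarK qstarD qstarZ qstarM.

Lemma ppi0 : ppi (pzero P) = 0. Proof. by []. Qed.
Lemma ppi1 : ppi (pone P) = 1. Proof. by []. Qed.
Lemma ppiD x y : ppi (padd x y) = ppi x + ppi y.
Proof. by rewrite -qaddE. Qed.
Lemma ppiN x : ppi (popp x) = - ppi x.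
Proof. by rewrite -qoppE. Qed.
Lemma ppiM x y : ppi (pmul x y) = ppi x * ppi y.
Proof. by rewrite -qmulE. Qed.
Lemma ppiZ k x : ppi (pscale k x) = k *: ppi x.
Proof. by rewrite -qscaleE. Qed.
Lemma ppi_star x : ppi (pstar x) = star (ppi x).
Proof. by rewrite -qstarE. Qed.

End Quotient.

Definition S3pq_rel (R : realType) (p q : R) (A : starAlgType R) (a b : A) :=
  [/\ star a * a - q%:C *: (a * star a) = (1 - q)%:C *: 1,
      star b * b - p%:C *: (b * star b) = (1 - p)%:C *: 1,
      a * b = b * a,
      star a * b = b * star a &
      (1 - a * star a) * (1 - b * star b) = 0].

(* Formal *-algebra expressions in the letters SA and SB. *)
Inductive sterm (R : realType) : Type :=
| SA | SB | SZero | SOne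
| SAdd of sterm R & sterm R
| SOpp of sterm R
| SMul of sterm R & sterm R
| SScale of R[i] & sterm R
| SStar of sterm R.
Arguments SA {R}.
Arguments SB {R}.
Arguments SZero {R}.
Arguments SOne {R}.

Section Presentation.
Variables (R : realType) (p q : R).

(* The least congruence containing the axioms of unital *-algebras and the
   five defining relations. *)
Inductive seqv : sterm R -> sterm R -> Prop :=
| seqv_refl x : seqv x x
| seqv_sym x y : seqv x y -> seqv y x
| seqv_trans x y z : seqv x y -> seqv y z -> seqv x z
| seqv_add x x' y y' : seqv x x' -> seqv y y' -> seqv (SAdd x y) (SAdd x' y')
| seqv_opp x x' : seqv x x' -> seqv (SOpp x) (SOpp x')
| seqv_mul x x' y y' : seqv x x' -> seqv y y' -> seqv (SMul x y) (SMul x' y')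
| seqv_scale k x x' : seqv x x' -> seqv (SScale k x) (SScale k x')
| seqv_star x x' : seqv x x' -> seqv (SStar x) (SStar x')
| seqv_addA x y z : seqv (SAdd x (SAdd y z)) (SAdd (SAdd x y) z)
| seqv_addC x y : seqv (SAdd x y) (SAdd y x)
| seqv_add0 x : seqv (SAdd SZero x) x
| seqv_addN x : seqv (SAdd (SOpp x) x) SZero
| seqv_mulA x y z : seqv (SMul x (SMul y z)) (SMul (SMul x y) z)
| seqv_mul1l x : seqv (SMul SOne x) x
| seqv_mul1r x : seqv (SMul x SOne) x
| seqv_mulDl x y z : seqv (SMul (SAdd x y) z) (SAdd (SMul x z) (SMul y z))
| seqv_mulDr x y z : seqv (SMul x (SAdd y z)) (SAdd (SMul x y) (SMul x z))
| seqv_scaleA k l x : seqv (SScale k (SScale l x)) (SScale (k * l) x)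
| seqv_scale1 x : seqv (SScale 1 x) x
| seqv_scaleDr k x y :
    seqv (SScale k (SAdd x y)) (SAdd (SScale k x) (SScale k y))
| seqv_scaleDl k l x :
    seqv (SScale (k + l) x) (SAdd (SScale k x) (SScale l x))
| seqv_scaleAl k x y : seqv (SScale k (SMul x y)) (SMul (SScale k x) y)
| seqv_scaleAr k x y : seqv (SScale k (SMul x y)) (SMul x (SScale k y))
| seqv_starK x : seqv (SStar (SStar x)) x
| seqv_starD x y : seqv (SStar (SAdd x y)) (SAdd (SStar x) (SStar y))
| seqv_starZ k x : seqv (SStar (SScale k x)) (SScale (Num.conj k) (SStar x))
| seqv_starM x y : seqv (SStar (SMul x y)) (SMul (SStar y) (SStar x))
| seqv_relA :
    seqv (SAdd (SMul (SStar SA) SA) (SOpp (SScale q%:C (SMul SA (SStar SA)))))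
         (SScale (1 - q)%:C SOne)
| seqv_relB :
    seqv (SAdd (SMul (SStar SB) SB) (SOpp (SScale p%:C (SMul SB (SStar SB)))))
         (SScale (1 - p)%:C SOne)
| seqv_relAB : seqv (SMul SA SB) (SMul SB SA)
| seqv_relA'B : seqv (SMul (SStar SA) SB) (SMul SB (SStar SA))
| seqv_rel0 :
    seqv (SMul (SAdd SOne (SOpp (SMul SA (SStar SA))))
               (SAdd SOne (SOpp (SMul SB (SStar SB)))))
         SZero.

Fixpoint seval (A : starAlgType R) (a b : A) (t : sterm R) : A :=
  match t with
  | SA => a
  | SB => b
  | SZero => 0
  | SOne => 1
  | SAdd x y => seval a b x + seval a b y
  | SOpp x => - seval a b x
  | SMul x y => seval a b x * seval a b y
  | SScale k x => k *: seval a b x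
  | SStar x => star (seval a b x)
  end.

Lemma seval_seqv (A : starAlgType R) (a b : A) :
  S3pq_rel p q a b -> forall s t, seqv s t -> seval a b s = seval a b t.
Proof.
move=> [ra rb rab ra'b r0] s t; elim=> //= *; try congruence.
- exact: addrA.
- exact: addrC.
- exact: add0r.
- exact: addNr.
- exact: mulrA.
- exact: mul1r.
- exact: mulr1.
- exact: mulrDl.
- exact: mulrDr.
- exact: scalerA.
- exact: scale1r.
- exact: scalerDr.
- exact: scalerDl.
- exact: scalerAl.
- exact: scalerAr.
- exact: starK.
- exact: starD.
- exact: starZ.
- exact: starM.
Qed.

Lemma S3pq_rel11 : S3pq_rel p q (1 : R[i]^o) (1 : R[i]^o).
Proof.
split=> //; rewrite ?star1 ?mulr1 ?subrr ?mul0r //; rewrite /GRing.scale /= !mulr1.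
  by rewrite rmorphB rmorph1.
by rewrite rmorphB rmorph1.
Qed.

Lemma sone_neq0 : ~ seqv SOne SZero.
Proof.
by move=> /(seval_seqv S3pq_rel11) /= /eqP; rewrite oner_eq0.
Qed.

Definition S3pq_pre : preStarAlg R := PreStarAlg
  seqv_refl seqv_sym seqv_trans seqv_add seqv_opp seqv_mul seqv_scale seqv_star
  seqv_addA seqv_addC seqv_add0 seqv_addN seqv_mulA seqv_mul1l seqv_mul1r
  seqv_mulDl seqv_mulDr sone_neq0 seqv_scaleA seqv_scale1 seqv_scaleDr
  seqv_scaleDl seqv_scaleAl seqv_scaleAr seqv_starK seqv_starD seqv_starZ
  seqv_starM.

(* The universal unital *-algebra on two generators subject to S3pq_rel; the
   universal property is OS3pq_rel, OS3pq_lift_ex and OS3pq_lift_unique. *)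
Definition OS3pq : Type := pquot S3pq_pre.
HB.instance Definition _ := StarAlgebra.on OS3pq.

Definition gena : OS3pq := ppi (SA : S3pq_pre).
Definition genb : OS3pq := ppi (SB : S3pq_pre).

Lemma seval_gen t : seval gena genb t = ppi (t : S3pq_pre).
Proof.
elim: t => //=.
- by move=> x -> y ->; rewrite -(ppiD (x : S3pq_pre)).
- by move=> x ->; rewrite -(ppiN (x : S3pq_pre)).
- by move=> x -> y ->; rewrite -(ppiM (x : S3pq_pre)).
- by move=> k x ->; rewrite -(ppiZ k (x : S3pq_pre)).
- by move=> x ->; rewrite -(ppi_star (x : S3pq_pre)).
Qed.

Lemma OS3pq_rel : S3pq_rel p q gena genb.
Proof.
have E s t : seqv s t -> seval gena genb s = seval gena genb t.
  by move=> st; rewrite !seval_gen; apply/ppiP.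
split.
- exact: (E _ _ seqv_relA).
- exact: (E _ _ seqv_relB).
- exact: (E _ _ seqv_relAB).
- exact: (E _ _ seqv_relA'B).
- exact: (E _ _ seqv_rel0).
Qed.

Section Lift.
Variables (A : starAlgType R) (a b : A).
Hypothesis rab : S3pq_rel p q a b.

Definition OS3pq_lift (x : OS3pq) : A := seval a b (prepr x).

Lemma OS3pq_liftE t : OS3pq_lift (ppi (t : S3pq_pre)) = seval a b t.
Proof. exact: (seval_seqv rab (prepr_pi (t : S3pq_pre))). Qed.

End Lift.

Lemma OS3pq_lift_ex (A : starAlgType R) (a b : A) : S3pq_rel p q a b ->
  exists f : {lrmorphism OS3pq -> A},
    [/\ {morph f : x / star x >-> star x}, f gena = a & f genb = b].
Proof.
move=> rab; have E := OS3pq_liftE rab.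
have lf : linear (OS3pq_lift a b).
  move=> k; elim/pquotW => x; elim/pquotW => y.
  by rewrite -ppiZ -ppiD !E.
have mf : monoid_morphism (OS3pq_lift a b).
  split; first by rewrite -ppi1 E.
  elim/pquotW => x; elim/pquotW => y.
  by rewrite -ppiM !E.
pose m1 := GRing.isLinear.Build _ _ _ _ (OS3pq_lift a b) lf.
pose m2 := GRing.isMonoidMorphism.Build _ _ (OS3pq_lift a b) mf.
pose f : {lrmorphism OS3pq -> A} := HB.pack (OS3pq_lift a b) m1 m2.
exists f; split; [|exact: E|exact: E].
by elim/pquotW => x; rewrite -ppi_star /= !E.
Qed.

Lemma OS3pq_lift_unique (A : starAlgType R) (f g : {lrmorphism OS3pq -> A}) :
  {morph f : x / star x >-> star x} -> {morph g : x / star x >-> star x} ->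
  f gena = g gena -> f genb = g genb -> f =1 g.
Proof.
move=> fs gs fga fgb; elim/pquotW => t; rewrite -seval_gen.
elim: t => //=.
- by rewrite !raddf0.
- by rewrite !rmorph1.
- by move=> x hx y hy; rewrite !raddfD /= hx hy.
- by move=> x hx; rewrite !raddfN /= hx.
- by move=> x hx y hy; rewrite !rmorphM /= hx hy.
- by move=> k x hx; rewrite !linearZ /= hx.
- by move=> x hx; rewrite fs gs /= hx.
Qed.

End Presentation.

Section Sequences.
Variables (R : realType) (A : zmodType) (N : A -> R).

Definition cauchy_seq (u : nat -> A) := forall e : R, 0 < e ->
  exists n0, forall m n, (n0 <= m)%N -> (n0 <= n)%N -> N (u m - u n) < e.

Definition cvg_seq (u : nat -> A) (l : A) := N (u n - l) @[n --> \oo] --> (0 : R).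

End Sequences.

(* The norm is a separate real-valued operation: the library hierarchy has no
   join of rings and normed modules other than NumDomain, so `|_| cannot be
   used on a structure that is also an algebra. *)
HB.mixin Record isCStar (R : realType) A & StarAlgebra R A := {
  cnorm : A -> R;
  ler_cnormD : forall x y : A, cnorm (x + y) <= cnorm x + cnorm y;
  cnormZ : forall (k : R[i]) (x : A), (cnorm (k *: x))%:C = `|k| * (cnorm x)%:C;
  cnorm0_eq0 : forall x : A, cnorm x = 0 -> x = 0;
  ler_cnormM : forall x y : A, cnorm (x * y) <= cnorm x * cnorm y;
  cnorm_star : forall x : A, cnorm (star x * x) = cnorm x ^+ 2;
  cnorm_complete : forall u : nat -> A,
    cauchy_seq cnorm u -> exists l, cvg_seq cnorm u l
}.

#[short(type="cstarAlgType")]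
HB.structure Definition CStarAlgebra (R : realType) :=
  { A of StarAlgebra R A & isCStar R A }.

Record cstarSeminorm (R : realType) (A : starAlgType R) := CStarSeminorm {
  csn :> A -> R;
  csnD : forall x y, csn (x + y) <= csn x + csn y;
  csnZ : forall (k : R[i]) x, (csn (k *: x))%:C = `|k| * (csn x)%:C;
  csnM : forall x y, csn (x * y) <= csn x * csn y;
  csn_star : forall x, csn (star x * x) = csn x ^+ 2;
  csn1 : csn 1 != 0
}.

Section Completion.
Variables (R : realType) (A : starAlgType R) (N : cstarSeminorm A).

Lemma csnZ' (k : R[i]) (x : A) : N (k *: x) = complex.Re `|k| * N x.
Proof. by apply: complexI; rewrite csnZ -{1}(RRe_real (normr_real k)) -rmorphM. Qed.

Lemma csn0 : N 0 = 0.
Proof. by rewrite -(scale0r (0 : A)) csnZ' normr0 mul0r. Qed.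

Lemma csnN (x : A) : N (- x) = N x.
Proof. by rewrite -scaleN1r csnZ' normrN1 mul1r. Qed.

Lemma csn_ge0 (x : A) : 0 <= N x.
Proof.
have := csnD N x (- x); rewrite subrr csn0 csnN -mulr2n.
by rewrite pmulrn_lge0.
Qed.

Lemma csnB (x y : A) : N (x - y) = N (y - x).
Proof. by rewrite -csnN opprB. Qed.

Lemma csn_triangle (x y z : A) : N (x - z) <= N (x - y) + N (y - z).
Proof. by rewrite (le_trans _ (csnD N _ _)) // addrA subrK. Qed.

Lemma csn_dist (x y : A) : `|N x - N y| <= N (x - y).
Proof.
have h a b : N a <= N (a - b) + N b by rewrite (le_trans _ (csnD N _ _)) // subrK.
by rewrite ler_norml lerNl opprB !lerBlDr h csnB h.
Qed.

Lemma csn_starE (x : A) : N (star x) = N x.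
Proof.
have le y : N y <= N (star y).
  have [->|y0] := eqVneq (N y) 0; first exact: csn_ge0.
  have {}y0 : 0 < N y by rewrite lt0r y0 csn_ge0.
  by rewrite -(ler_pM2r y0) -expr2 -csn_star csnM.
by apply/eqP; rewrite eq_le le andbT -{2}(starK x) le.
Qed.

Lemma cauchy_csn_cvg (u : nat -> A) : cauchy_seq N u -> cvgn (N \o u).
Proof.
move=> cu; apply: R_complete; apply: cauchy_exP => e e0.
have [n0 h] := cu _ e0; exists (N (u n0)); exists n0 => // n /= n0n.
by rewrite -ball_normE /=; apply: le_lt_trans (csn_dist _ _) _; exact: h.
Qed.

Lemma cauchy_bounded (u : nat -> A) : cauchy_seq N u -> exists2 M, 0 < M & forall n, N (u n) <= M.
Proof.
move=> /cauchy_csn_cvg /cvg_seq_bounded [M [Mr h]].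
exists (Num.max (M + 1) 1); first by rewrite lt_max ltr01 orbT.
move=> n; apply: le_trans (ler_norm _) _; apply: h => //=.
by rewrite lt_max ltrDl ltr01.
Qed.

Lemma cauchy_cst (x : A) : cauchy_seq N (fun=> x).
Proof. by move=> e e0; exists 0%N => *; rewrite subrr csn0. Qed.

Lemma cauchyD (u v : nat -> A) : cauchy_seq N u -> cauchy_seq N v ->
  cauchy_seq N (fun n => u n + v n).
Proof.
move=> cu cv e e0; have e2 : 0 < e / 2 by rewrite divr_gt0.
have [n1 h1] := cu _ e2; have [n2 h2] := cv _ e2.
exists (maxn n1 n2) => m n; rewrite !geq_max => /andP[m1 m2] /andP[l1 l2].
rewrite opprD addrACA (le_lt_trans (csnD N _ _)) // (splitr e) ltrD //.
  exact: h1.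
exact: h2.
Qed.

Lemma cauchyN (u : nat -> A) : cauchy_seq N u -> cauchy_seq N (fun n => - u n).
Proof.
move=> cu e /cu[n0 h]; exists n0 => m n hm hn.
by rewrite -opprD csnN; exact: h.
Qed.

Lemma cauchyM (u v : nat -> A) : cauchy_seq N u -> cauchy_seq N v ->
  cauchy_seq N (fun n => u n * v n).
Proof.
move=> cu cv e e0.
have [M M0 hM] := cauchy_bounded cu; have [L L0 hL] := cauchy_bounded cv.
have e1 : 0 < e / 2 / L by rewrite !divr_gt0.
have e2 : 0 < e / 2 / M by rewrite !divr_gt0.
have [n1 h1] := cu _ e1; have [n2 h2] := cv _ e2.
exists (maxn n1 n2) => m n; rewrite !geq_max => /andP[m1 m2] /andP[l1 l2].
have -> : u m * v m - u n * v n = (u m - u n) * v m + u n * (v m - v n).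
  by rewrite mulrBl mulrBr addrA subrK.
apply: le_lt_trans (csnD N _ _) _; rewrite (splitr e) ltrD //.
  apply: le_lt_trans (csnM N _ _) _.
  apply: (@le_lt_trans _ _ (N (u m - u n) * L)).
    by rewrite ler_wpM2l ?csn_ge0.
  by rewrite -ltr_pdivlMr // h1.
apply: le_lt_trans (csnM N _ _) _.
apply: (@le_lt_trans _ _ (M * N (v m - v n))).
  by rewrite ler_wpM2r ?csn_ge0.
by rewrite mulrC -ltr_pdivlMr // h2.
Qed.

Lemma cauchyZ k (u : nat -> A) : cauchy_seq N u -> cauchy_seq N (fun n => k *: u n).
Proof.
move=> /(cauchyM (cauchy_cst (k *: 1))); congr (cauchy_seq _ _).
by apply/funext => n; rewrite -scalerAl mul1r.
Qed.

Lemma cauchy_star (u : nat -> A) : cauchy_seq N u -> cauchy_seq N (fun n => star (u n)).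
Proof.
move=> cu e /cu[n0 h]; exists n0 => m n hm hn.
by rewrite -starB csn_starE; exact: h.
Qed.

Definition cauchyT := {u : nat -> A | cauchy_seq N u}.

Definition cauchy_eq (u v : cauchyT) :=
  N (sval u n - sval v n) @[n --> \oo] --> (0 : R).

Definition c_cst (x : A) : cauchyT := exist _ _ (cauchy_cst x).
Definition c_add (u v : cauchyT) : cauchyT := exist _ _ (cauchyD (svalP u) (svalP v)).
Definition c_opp (u : cauchyT) : cauchyT := exist _ _ (cauchyN (svalP u)).
Definition c_mul (u v : cauchyT) : cauchyT := exist _ _ (cauchyM (svalP u) (svalP v)).
Definition c_scale k (u : cauchyT) : cauchyT := exist _ _ (cauchyZ k (svalP u)).
Definition c_star (u : cauchyT) : cauchyT := exist _ _ (cauchy_star (svalP u)).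

Lemma c_pointwise (u v : cauchyT) : sval u =1 sval v -> cauchy_eq u v.
Proof.
move=> uv; rewrite /cauchy_eq; under eq_fun do rewrite uv subrr csn0.
exact: cvg_cst.
Qed.

Lemma c_eq_le (f g : nat -> R) : g @ \oo --> (0 : R) ->
  (forall n, 0 <= f n <= g n) -> f @ \oo --> (0 : R).
Proof.
move=> g0 fg; apply: (@squeeze_cvgr _ _ _ _ (fun=> 0) g) => //.
  by apply: nearW.
exact: cvg_cst.
Qed.

Lemma c_cvg0D (f g : nat -> R) : f @ \oo --> (0 : R) -> g @ \oo --> (0 : R) ->
  (fun n => f n + g n) @ \oo --> (0 : R).
Proof. by move=> f0 g0; rewrite -(addr0 0); exact: cvgD. Qed.

Lemma c_cvg0Z (k : R) (f : nat -> R) : f @ \oo --> (0 : R) ->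
  (fun n => k * f n) @ \oo --> (0 : R).
Proof. by move=> f0; rewrite -(mulr0 k); exact: cvgMr. Qed.

Lemma c_eq_refl (u : cauchyT) : cauchy_eq u u.
Proof. exact: c_pointwise. Qed.

Lemma c_eq_sym (u v : cauchyT) : cauchy_eq u v -> cauchy_eq v u.
Proof. by rewrite /cauchy_eq; under eq_fun do rewrite csnB. Qed.

Lemma c_eq_trans (u v w : cauchyT) : cauchy_eq u v -> cauchy_eq v w -> cauchy_eq u w.
Proof.
move=> uv vw; apply: (c_eq_le (c_cvg0D uv vw)) => n.
by rewrite csn_ge0 csn_triangle.
Qed.

Lemma c_eq_add (u u' v v' : cauchyT) : cauchy_eq u u' -> cauchy_eq v v' ->
  cauchy_eq (c_add u v) (c_add u' v').
Proof.
move=> uv vw; apply: (c_eq_le (c_cvg0D uv vw)) => n /=.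
by rewrite csn_ge0 opprD addrACA csnD.
Qed.

Lemma c_eq_opp (u u' : cauchyT) : cauchy_eq u u' -> cauchy_eq (c_opp u) (c_opp u').
Proof.
move=> uu'; apply: (c_eq_le uu') => n /=.
by rewrite csn_ge0 opprK addrC csnB /=.
Qed.

Lemma c_eq_mul (u u' v v' : cauchyT) : cauchy_eq u u' -> cauchy_eq v v' ->
  cauchy_eq (c_mul u v) (c_mul u' v').
Proof.
move=> uv vw.
have [M M0 hM] := cauchy_bounded (svalP u'); have [L L0 hL] := cauchy_bounded (svalP v).
apply: (c_eq_le (c_cvg0D (c_cvg0Z L uv) (c_cvg0Z M vw))) => n /=; rewrite csn_ge0 /=.
have -> : sval u n * sval v n - sval u' n * sval v' n =
   (sval u n - sval u' n) * sval v n + sval u' n * (sval v n - sval v' n).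
  by rewrite mulrBl mulrBr addrA subrK.
apply: le_trans (csnD N _ _) _; apply: lerD.
  by apply: le_trans (csnM N _ _) _; rewrite mulrC ler_wpM2r ?csn_ge0 ?hL.
by apply: le_trans (csnM N _ _) _; rewrite ler_wpM2r ?csn_ge0 ?hM.
Qed.

Lemma c_eq_scale k (u u' : cauchyT) : cauchy_eq u u' -> cauchy_eq (c_scale k u) (c_scale k u').
Proof.
move=> uu'; apply: (c_eq_le (c_cvg0Z (complex.Re `|k|) uu')) => n /=.
by rewrite csn_ge0 -scalerBr csnZ' /=.
Qed.

Lemma c_eq_star (u u' : cauchyT) : cauchy_eq u u' -> cauchy_eq (c_star u) (c_star u').
Proof.
move=> uu'; apply: (c_eq_le uu') => n /=.
by rewrite csn_ge0 -starB csn_starE /=.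
Qed.

Lemma c_cstP (x y : A) : cauchy_eq (c_cst x) (c_cst y) <-> N (x - y) = 0.
Proof.
split=> [|h]; rewrite /cauchy_eq /=; last by rewrite h; exact: cvg_cst.
by move=> h; apply/esym; apply: cvg_unique h (cvg_cst _).
Qed.

Lemma c_one_neq0 : ~ cauchy_eq (c_cst 1) (c_cst 0).
Proof. by rewrite c_cstP subr0; apply/eqP; exact: csn1. Qed.

Definition completion_pre : preStarAlg R.
refine (@PreStarAlg R cauchyT cauchy_eq (c_cst 0) (c_cst 1) c_add c_opp c_mul
  c_scale c_star c_eq_refl c_eq_sym c_eq_trans c_eq_add c_eq_opp c_eq_mul
  c_eq_scale c_eq_star _ _ _ _ _ _ _ _ _ c_one_neq0 _ _ _ _ _ _ _ _ _ _);
  move=> *; apply: c_pointwise => n /=.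
- exact: addrA.
- exact: addrC.
- exact: add0r.
- exact: addNr.
- exact: mulrA.
- exact: mul1r.
- exact: mulr1.
- exact: mulrDl.
- exact: mulrDr.
- exact: scalerA.
- exact: scale1r.
- exact: scalerDr.
- exact: scalerDl.
- exact: scalerAl.
- exact: scalerAr.
- exact: starK.
- exact: starD.
- exact: starZ.
- exact: starM.
Defined.

(* Cauchy sequences of (A, N) modulo null sequences; elements of seminorm zero
   are thereby divided out. *)
Definition completion : Type := pquot completion_pre.
HB.instance Definition _ := StarAlgebra.on completion.

Definition ccls (u : cauchyT) : completion := ppi (u : completion_pre).

Lemma completionW (T : completion -> Prop) :
  (forall u, T (ccls u)) -> forall x : completion, T x.
Proof. by move=> h; elim/pquotW. Qed.

Lemma cclsP (u v : cauchyT) : ccls u = ccls v <-> cauchy_eq u v.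
Proof. exact: ppiP. Qed.

Lemma cclsD (u v : cauchyT) : ccls u + ccls v = ccls (c_add u v).
Proof. by rewrite /ccls -(ppiD (u : completion_pre)). Qed.
Lemma cclsN (u : cauchyT) : - ccls u = ccls (c_opp u).
Proof. by rewrite /ccls -(ppiN (u : completion_pre)). Qed.
Lemma cclsM (u v : cauchyT) : ccls u * ccls v = ccls (c_mul u v).
Proof. by rewrite /ccls -(ppiM (u : completion_pre)). Qed.
Lemma cclsZ k (u : cauchyT) : k *: ccls u = ccls (c_scale k u).
Proof. by rewrite /ccls -(ppiZ k (u : completion_pre)). Qed.
Lemma ccls_star (u : cauchyT) : star (ccls u) = ccls (c_star u).
Proof. by rewrite /ccls -(ppi_star (u : completion_pre)). Qed.
Definition cclsE := (cclsD, cclsN, cclsM, cclsZ, ccls_star).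

Definition completion_norm (x : completion) : R :=
  limn (fun n => N (sval (prepr x : cauchyT) n)).

Lemma completion_normP (u : cauchyT) : N (sval u n) @[n --> \oo] --> completion_norm (ccls u).
Proof.
set v : cauchyT := prepr (ccls u).
have vc : N (sval v n) @[n --> \oo] --> completion_norm (ccls u).
  exact: (cauchy_csn_cvg (svalP v)).
have uv : cauchy_eq u v by apply: c_eq_sym; exact: (prepr_pi (u : completion_pre)).
rewrite -[completion_norm _]addr0.
have -> : (fun n => N (sval u n)) =
  (fun n => N (sval v n) + (N (sval u n) - N (sval v n))).
  by apply/funext => n; rewrite addrC subrK.
apply: cvgD vc _; apply: norm_cvg0.
by apply: (c_eq_le uv) => n; rewrite normr_ge0 csn_dist.
Qed.

Arguments completion_normP u : clear implicits.

Lemma completion_normE (u : cauchyT) (l : R) :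
  N (sval u n) @[n --> \oo] --> l -> completion_norm (ccls u) = l.
Proof. by move=> h; exact: cvg_unique (completion_normP u) h. Qed.

Lemma completion_norm_ge0 (x : completion) : 0 <= completion_norm x.
Proof.
elim/completionW: x => u; rewrite -(cvg_lim _ (completion_normP u)) //.
apply: limr_ge; first by apply/cvg_ex; eexists; exact: completion_normP.
by apply: nearW => n; exact: csn_ge0.
Qed.

Lemma completion_le (u v : cauchyT) : (forall n, N (sval u n) <= N (sval v n)) ->
  completion_norm (ccls u) <= completion_norm (ccls v).
Proof.
move=> h; apply: (ler_cvg_to (completion_normP u) (completion_normP v)).
by apply: nearW.
Qed.

Lemma completion_normD (x y : completion) :
  completion_norm (x + y) <= completion_norm x + completion_norm y.
Proof.
elim/completionW: x => u; elim/completionW: y => v; rewrite !cclsE.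
apply: (ler_cvg_to (completion_normP _)
  (cvgD (completion_normP u) (completion_normP v))).
by apply: nearW => n; exact: csnD.
Qed.

Lemma completion_normZ (k : R[i]) (x : completion) :
  (completion_norm (k *: x))%:C = `|k| * (completion_norm x)%:C.
Proof.
elim/completionW: x => u; rewrite !cclsE.
rewrite -[ `|k| ]RRe_real ?normr_real // -rmorphM; congr _%:C.
apply: completion_normE => /=; under eq_fun do rewrite csnZ'.
exact: cvgMr (completion_normP u).
Qed.

Lemma completion_norm0_eq0 (x : completion) : completion_norm x = 0 -> x = 0.
Proof.
elim/completionW: x => u u0; apply/cclsP.
rewrite /cauchy_eq /=; under eq_fun do rewrite subr0.
by rewrite -u0; exact: completion_normP.
Qed.

Lemma completion_normM (x y : completion) :
  completion_norm (x * y) <= completion_norm x * completion_norm y.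
Proof.
elim/completionW: x => u; elim/completionW: y => v; rewrite !cclsE.
apply: (ler_cvg_to (completion_normP _)
  (cvgM (completion_normP u) (completion_normP v))).
by apply: nearW => n; exact: csnM.
Qed.

Lemma completion_norm_star (x : completion) :
  completion_norm (star x * x) = completion_norm x ^+ 2.
Proof.
elim/completionW: x => u; rewrite !cclsE; apply: completion_normE => /=.
under eq_fun do rewrite csn_star expr2.
by rewrite expr2; exact: cvgM (completion_normP u) (completion_normP u).
Qed.

Definition completion_emb (x : A) : completion := ccls (c_cst x).

Lemma completion_emb_linear : linear completion_emb.
Proof.
by move=> k x y; rewrite /completion_emb !cclsE; apply/cclsP; exact: c_pointwise.
Qed.

Lemma completion_emb_monoid : monoid_morphism completion_emb.
Proof.
split=> // x y; rewrite /completion_emb !cclsE; apply/cclsP.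
exact: c_pointwise.
Qed.

HB.instance Definition _ :=
  GRing.isLinear.Build R[i] A completion _ completion_emb completion_emb_linear.
HB.instance Definition _ :=
  GRing.isMonoidMorphism.Build A completion completion_emb completion_emb_monoid.

Lemma completion_emb_star (x : A) : completion_emb (star x) = star (completion_emb x).
Proof. by rewrite /completion_emb !cclsE; apply/cclsP; exact: c_pointwise. Qed.

Lemma completion_emb_norm (x : A) : completion_norm (completion_emb x) = N x.
Proof. by apply: completion_normE => /=; exact: cvg_cst. Qed.

Lemma completion_emb_cvg (u : cauchyT) :
  completion_norm (completion_emb (sval u n) - ccls u) @[n --> \oo] --> (0 : R).
Proof.
apply/cvgrPdist_le => e e0; have [n0 h] := svalP u _ e0.
exists n0 => // n /= n0n; rewrite sub0r normrN ger0_norm ?completion_norm_ge0 //.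
rewrite /completion_emb !cclsE.
apply: (ler_cvg_to (completion_normP _) (cvg_cst e)).
by exists n0 => // m /= n0m; apply: ltW; exact: h.
Qed.

Arguments completion_emb_cvg u : clear implicits.

Lemma completion_dense (x : completion) (e : R) : 0 < e ->
  exists y, completion_norm (x - completion_emb y) < e.
Proof.
elim/completionW: x => u e0.
have /cvgrPdist_lt /(_ _ e0) [n0 _ h] := completion_emb_cvg u.
exists (sval u n0); have := h n0 (leqnn _).
rewrite sub0r normrN ger0_norm ?completion_norm_ge0 // => /le_lt_trans; apply.
rewrite -opprB -scaleN1r -lecR completion_normZ normrN1 mul1r.
by [].
Qed.

Lemma completion_normB (x y : completion) : completion_norm (x - y) = completion_norm (y - x).
Proof.
by apply: complexI; rewrite -opprB -scaleN1r completion_normZ normrN1 mul1r.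
Qed.

Lemma completion_complete (u : nat -> completion) :
  cauchy_seq completion_norm u -> exists l, cvg_seq completion_norm u l.
Proof.
move=> cu.
have ex n : exists y, completion_norm (u n - completion_emb y) < n.+1%:R^-1.
  by apply: completion_dense; rewrite invr_gt0.
pose a n := sval (cid (ex n)).
have ha n : completion_norm (u n - completion_emb (a n)) < n.+1%:R^-1.
  exact: (svalP (cid (ex n))).
have small (e : R) : 0 < e -> exists n0, forall n, (n0 <= n)%N ->
    completion_norm (u n - completion_emb (a n)) < e.
  move=> e0.
  have /cvgrPdist_lt /(_ _ e0) [n0 _ h] := @cvg_harmonic R.
  exists n0 => n /h /=; rewrite sub0r normrN ger0_norm ?invr_ge0 //.
  by move=> /(lt_trans (ha n)).
have tri x y z : completion_norm (x - z) <=
    completion_norm (x - y) + completion_norm (y - z).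
  by rewrite (le_trans _ (completion_normD _ _)) // addrA subrK.
have ca : cauchy_seq N a.
  move=> e e0; have e3 : 0 < e / 3 by rewrite divr_gt0.
  have [n1 h1] := small _ e3; have [n2 h2] := cu _ e3.
  exists (maxn n1 n2) => m n; rewrite !geq_max => /andP[m1 m2] /andP[l1 l2].
  rewrite -completion_emb_norm raddfB /=.
  apply: le_lt_trans (tri _ (u m) _) _.
  apply: (@le_lt_trans _ _ (e / 3 + (e / 3 + completion_norm (u n - completion_emb (a n))))).
    rewrite lerD //; first by rewrite completion_normB ltW // h1.
    by apply: le_trans (tri _ (u n) _) _; rewrite lerD // ltW // h2.
  have h3 := h1 n l1; lra.
exists (ccls (exist _ a ca)); rewrite /cvg_seq.
have h0 : completion_norm (u n - completion_emb (a n)) @[n --> \oo] --> (0 : R).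
  apply: (c_eq_le (@cvg_harmonic R)) => n.
  by rewrite completion_norm_ge0 /= ltW.
apply: (c_eq_le (c_cvg0D h0 (completion_emb_cvg (exist _ a ca)))) => n.
by rewrite completion_norm_ge0 /= tri.
Qed.

HB.instance Definition _ := isCStar.Build R completion
  completion_normD completion_normZ completion_norm0_eq0 completion_normM
  completion_norm_star completion_complete.

End Completion.

HB.mixin Record isHilbert (R : realType) H & CompleteNormedModule R[i] H := {
  hdot : {dot H for @Num.conj R[i]};
  hnormE : forall v : H, `|v| ^+ 2 = hdot v v
}.

#[short(type="hilbertType")]
HB.structure Definition Hilbert (R : realType) :=
  { H of CompleteNormedModule R[i] H & isHilbert R H }.

Section HilbertTheory.
Variables (R : realType) (H : hilbertType R).
Implicit Types (u v w : H) (f g : H -> H).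

(* The library norm of H takes its values in R[i]. *)
Definition hnorm v : R := complex.Re `|v|.

Lemma normhE v : `|v| = (hnorm v)%:C.
Proof. by rewrite /hnorm RRe_real // normr_real. Qed.

Lemma hnorm_ge0 v : 0 <= hnorm v.
Proof. by rewrite -ler0c -normhE. Qed.

Lemma hnormD u v : hnorm (u + v) <= hnorm u + hnorm v.
Proof. by rewrite -lecR rmorphD /= -!normhE ler_normD. Qed.

Lemma hnormZ (k : R[i]) v : hnorm (k *: v) = complex.Re `|k| * hnorm v.
Proof.
apply: complexI; rewrite -normhE normrZ -{1}(RRe_real (normr_real k)) normhE.
by rewrite -rmorphM.
Qed.

Lemma hnorm0 : hnorm 0 = 0.
Proof. by rewrite /hnorm normr0. Qed.

Lemma hnorm_eq0 v : hnorm v = 0 -> v = 0.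
Proof. by move=> v0; apply/eqP; rewrite -normr_eq0 normhE v0. Qed.

Lemma hnorm2 v : (hnorm v ^+ 2)%:C = hdot v v.
Proof. by rewrite -hnormE normhE -rmorphXn. Qed.

Lemma hdotC u v : hdot u v = Num.conj (hdot v u).
Proof. by rewrite (hermitian_subproof u v) expr0 mul1r. Qed.

Lemma cauchy_schwarz u v : `|hdot u v| <= (hnorm u * hnorm v)%:C.
Proof.
have [->|v0] := eqVneq v 0; first by rewrite linear0r normr0 hnorm0 mulr0.
have d0 : 0 < hdot v v by exact: neq0_dnorm_gt0.
have dc : Num.conj (hdot v v) = hdot v v by rewrite -hdotC.
set c := hdot u v; set d := hdot v v in d0 dc *.
have cc : hdot v u = Num.conj c by rewrite hdotC.
have : 0 <= hdot (d *: u - c *: v) (d *: u - c *: v).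
  by rewrite -hnorm2 ler0c sqr_ge0.
rewrite linearBl linearBr linearBr !linearZl_LR /= !linearZr_LR /= -/c -/d cc dc.
rewrite [X in 0 <= X](_ : _ = d * (d * hdot u u - `|c| ^+ 2)); last first.
  by rewrite normCK /GRing.scale /=; ring.
rewrite pmulr_rge0 // subr_ge0 => h.
rewrite -(@ler_pXn2r _ 2) ?nnegrE ?normr_ge0 // ?ler0c ?mulr_ge0 ?hnorm_ge0 //.
apply: le_trans h _; rewrite /d -!hnorm2 -rmorphM -rmorphXn lecR.
by rewrite exprMn mulrC.
Qed.

Definition opnorm f : R := sup [set r | exists2 v, `|v| <= 1 & `|f v| = r%:C].

Definition opbound f (M : R) := forall v, hnorm (f v) <= M * hnorm v.

Lemma continuous_opbound (f : {linear H -> H}) :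
  continuous f -> exists2 M, 0 <= M & opbound f M.
Proof.
move=> /linear_bounded_continuous /linear_boundedP /pinfty_ex_gt0 [M M0 h].
have Mr : M = (complex.Re M)%:C by rewrite RRe_real // gtr0_real.
exists (complex.Re M); first by rewrite -ler0c -Mr ltW.
by move=> v; rewrite -lecR -normhE (le_trans (h v)) // {1}Mr normhE -rmorphM.
Qed.

Section Bounded.
Variable f : {linear H -> H}.
Hypothesis fb : exists2 M, 0 <= M & opbound f M.

Lemma opnorm_has_sup : has_sup [set r | exists2 v : H, `|v| <= 1 & `|f v| = r%:C].
Proof.
have [M M0 h] := fb; split.
  by exists 0; exists 0; rewrite ?linear0 normr0 ?ler01.
exists M => r [v v1 vr].
have -> : r = hnorm (f v) by apply: complexI; rewrite -vr normhE.
apply: le_trans (h v) _; rewrite -[leRHS]mulr1 ler_wpM2l //.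
by rewrite -lecR -normhE.
Qed.

Lemma opnorm_ub v : hnorm v <= 1 -> hnorm (f v) <= opnorm f.
Proof.
move=> v1; apply: (ub_le_sup opnorm_has_sup.2); exists v.
  by rewrite normhE lecR.
by rewrite normhE.
Qed.

Lemma opnorm_ge0 : 0 <= opnorm f.
Proof.
apply: le_trans (opnorm_ub (v := 0) _); first exact: hnorm_ge0.
by rewrite hnorm0.
Qed.

Lemma opnormP : opbound f (opnorm f).
Proof.
move=> v; have [->|v0] := eqVneq v 0; first by rewrite linear0 hnorm0 mulr0.
have nv : 0 < hnorm v.
  by rewrite lt0r hnorm_ge0 andbT; apply: contra v0 => /eqP /hnorm_eq0 ->.
have nk : complex.Re `|(hnorm v)^-1%:C : R[i]| = (hnorm v)^-1.
  by rewrite ger0_norm // ler0c invr_ge0 ltW.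
have := @opnorm_ub ((hnorm v)^-1%:C *: v).
rewrite linearZ /= !hnormZ nk mulVf ?gt_eqF // => /(_ (lexx _)).
by rewrite mulrC ler_pdivrMr.
Qed.

Lemma opnorm_le M : 0 <= M -> opbound f M -> opnorm f <= M.
Proof.
move=> M0 h; apply: ge_sup; first exact: opnorm_has_sup.1.
move=> r [v v1 vr].
have -> : r = hnorm (f v) by apply: complexI; rewrite -vr normhE.
apply: le_trans (h v) _; rewrite -[leRHS]mulr1 ler_wpM2l //.
by rewrite -lecR -normhE.
Qed.

End Bounded.
End HilbertTheory.

(* A unital *-representation of A by bounded operators on H.  The field
   rep_star says that rep (star x) is the adjoint of rep x. *)
Record starRep (R : realType) (A : starAlgType R) (H : hilbertType R) := StarRep {
  rep :> A -> {linear H -> H};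
  rep_continuous : forall x, continuous (rep x);
  repD : forall x y v, rep (x + y) v = rep x v + rep y v;
  repZ : forall (k : R[i]) x v, rep (k *: x) v = k *: rep x v;
  rep1 : forall v, rep 1 v = v;
  repM : forall x y v, rep (x * y) v = rep x (rep y v);
  rep_star : forall x v w, hdot (rep (star x) v) w = hdot v (rep x w)
}.

Section RepTheory.
Variables (R : realType) (A : starAlgType R) (H : hilbertType R).
Variable rho : starRep A H.

Lemma rep_bounded x : exists2 M, 0 <= M & opbound (rho x) M.
Proof. exact: continuous_opbound (@rep_continuous _ _ _ rho x). Qed.
Let rb := rep_bounded.

Lemma opnorm_rep_ge0 x : 0 <= opnorm (rho x).
Proof. exact: opnorm_ge0. Qed.

Lemma opnorm_repD x y : opnorm (rho (x + y)) <= opnorm (rho x) + opnorm (rho y).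
Proof.
apply: opnorm_le => //; first by rewrite addr_ge0 ?opnorm_rep_ge0.
move=> v; rewrite repD mulrDl; apply: le_trans (hnormD _ _) _.
by apply: lerD; exact: opnormP.
Qed.

Lemma opnorm_repZ_le (k : R[i]) x :
  opnorm (rho (k *: x)) <= complex.Re `|k| * opnorm (rho x).
Proof.
have k0 : 0 <= complex.Re `|k| by rewrite -ler0c RRe_real ?normr_real.
apply: opnorm_le => //; first by rewrite mulr_ge0 ?opnorm_rep_ge0.
by move=> v; rewrite repZ hnormZ -mulrA ler_wpM2l //; exact: opnormP.
Qed.

Lemma opnorm_repM x y : opnorm (rho (x * y)) <= opnorm (rho x) * opnorm (rho y).
Proof.
apply: opnorm_le => //; first by rewrite mulr_ge0 ?opnorm_rep_ge0.
move=> v; rewrite repM -mulrA; apply: le_trans (opnormP (rb x) _) _.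
by apply: ler_wpM2l; [exact: opnorm_rep_ge0|exact: opnormP].
Qed.

Lemma opnorm_rep_star_le x : opnorm (rho x) ^+ 2 <= opnorm (rho (star x * x)).
Proof.
have s0 := opnorm_rep_ge0 (star x * x).
rewrite -(sqr_sqrtr s0) ler_pXn2r ?nnegrE ?sqrtr_ge0 ?opnorm_rep_ge0 //.
apply: opnorm_le => // v; rewrite -(@ler_pXn2r _ 2) ?nnegrE ?mulr_ge0 ?sqrtr_ge0 ?hnorm_ge0 //.
rewrite exprMn sqr_sqrtr // -lecR hnorm2 -rep_star -repM.
apply: le_trans (real_ler_norm _) _; last first.
  apply: le_trans (cauchy_schwarz _ _) _.
  by rewrite lecR expr2 mulrA ler_wpM2r ?hnorm_ge0 //; exact: opnormP.
by rewrite repM rep_star -hnorm2 ger0_real // ler0c sqr_ge0.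
Qed.

Lemma opnorm_rep_adj x : opnorm (rho (star x)) <= opnorm (rho x).
Proof.
have le y : opnorm (rho y) <= opnorm (rho (star y)).
  have [->|y0] := eqVneq (opnorm (rho y)) 0; first exact: opnorm_rep_ge0.
  have {}y0 : 0 < opnorm (rho y) by rewrite lt0r y0 opnorm_rep_ge0.
  rewrite -(ler_pM2r y0) -expr2.
  by apply: le_trans (opnorm_rep_star_le _) _; exact: opnorm_repM.
by rewrite -{2}(starK x) le.
Qed.

Lemma opnorm_rep_star x : opnorm (rho (star x * x)) = opnorm (rho x) ^+ 2.
Proof.
apply/eqP; rewrite eq_le opnorm_rep_star_le andbT.
apply: le_trans (opnorm_repM _ _) _.
by rewrite expr2 ler_wpM2r ?opnorm_rep_ge0 ?opnorm_rep_adj.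
Qed.

Lemma opnorm_rep1 : opnorm (rho 1) <= 1.
Proof. by apply: opnorm_le => // v; rewrite rep1 mul1r. Qed.

Lemma opnorm_rep0 : opnorm (rho 0) <= 0.
Proof.
apply: opnorm_le => // v; rewrite -(scale0r (0 : A)) repZ scale0r hnorm0.
by rewrite mul0r.
Qed.

End RepTheory.

Section Enveloping.
Variables (R : realType) (A : starAlgType R).

Definition rep_norms (x : A) : set R :=
  [set r | exists (H : hilbertType R) (rho : starRep A H), r = opnorm (rho x)].

Definition rep_norm (x : A) : R := sup (rep_norms x).

Hypothesis bnd : forall x : A, has_ubound (rep_norms x).
Hypothesis nt : exists (H : hilbertType R) (rho : starRep A H), opnorm (rho 1) != 0.

Lemma rep_norms_neq0 x : rep_norms x !=set0.
Proof. by have [H [rho _]] := nt; exists (opnorm (rho x)), H, rho. Qed.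

Lemma rep_norm_ub x (H : hilbertType R) (rho : starRep A H) :
  opnorm (rho x) <= rep_norm x.
Proof. by apply: (ub_le_sup (bnd x)); exists H, rho. Qed.

Lemma rep_norm_le x (M : R) :
  (forall (H : hilbertType R) (rho : starRep A H), opnorm (rho x) <= M) ->
  rep_norm x <= M.
Proof.
move=> h; apply: ge_sup; first exact: rep_norms_neq0.
by move=> r [H [rho ->]]; exact: h.
Qed.

Lemma rep_norm_ge0 x : 0 <= rep_norm x.
Proof.
have [H [rho _]] := nt.
exact: le_trans (opnorm_rep_ge0 rho x) (rep_norm_ub x rho).
Qed.

Lemma rep_normD x y : rep_norm (x + y) <= rep_norm x + rep_norm y.
Proof.
apply: rep_norm_le => H rho; apply: le_trans (opnorm_repD rho _ _) _.
by apply: lerD; exact: rep_norm_ub.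
Qed.

Lemma rep_normM x y : rep_norm (x * y) <= rep_norm x * rep_norm y.
Proof.
apply: rep_norm_le => H rho; apply: le_trans (opnorm_repM rho _ _) _.
by apply: ler_pM; rewrite ?opnorm_rep_ge0 //; exact: rep_norm_ub.
Qed.

Lemma rep_normZ_le (k : R[i]) x : rep_norm (k *: x) <= complex.Re `|k| * rep_norm x.
Proof.
apply: rep_norm_le => H rho; apply: le_trans (opnorm_repZ_le rho _ _) _.
apply: ler_wpM2l; last exact: rep_norm_ub.
by rewrite -ler0c RRe_real ?normr_real.
Qed.

Lemma rep_norm0 : rep_norm 0 = 0.
Proof.
apply/eqP; rewrite eq_le rep_norm_ge0 andbT.
by apply: rep_norm_le => H rho; exact: opnorm_rep0.
Qed.

Lemma rep_normZ (k : R[i]) x : (rep_norm (k *: x))%:C = `|k| * (rep_norm x)%:C.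
Proof.
rewrite -[ `|k| ](RRe_real (normr_real k)) -rmorphM; congr _%:C; apply/eqP.
rewrite eq_le rep_normZ_le andTb.
have [->|k0] := eqVneq k 0; first by rewrite scale0r rep_norm0 normr0 mul0r.
have := rep_normZ_le k^-1 (k *: x); rewrite scalerA mulVf // scale1r.
have nk : (complex.Re `|k| )%:C = `|k| by rewrite RRe_real ?normr_real.
have kp : 0 < complex.Re `|k| by rewrite -ltcR nk normr_gt0.
have -> : complex.Re `|k^-1| = (complex.Re `|k| )^-1.
  by apply: complexI; rewrite RRe_real ?normr_real // normfV -nk fmorphV.
by rewrite mulrC ler_pdivlMr // mulrC.
Qed.

Lemma rep_norm_star x : rep_norm (star x * x) = rep_norm x ^+ 2.
Proof.
have s0 := rep_norm_ge0 (star x * x).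
apply/eqP; rewrite eq_le; apply/andP; split.
  apply: rep_norm_le => H rho; rewrite opnorm_rep_star.
  rewrite ler_pXn2r ?nnegrE ?opnorm_rep_ge0 ?rep_norm_ge0 //.
  exact: rep_norm_ub.
rewrite -(sqr_sqrtr s0) ler_pXn2r ?nnegrE ?sqrtr_ge0 ?rep_norm_ge0 //.
apply: rep_norm_le => H rho.
rewrite -(@ler_pXn2r _ 2) ?nnegrE ?sqrtr_ge0 ?opnorm_rep_ge0 //.
by rewrite sqr_sqrtr // -opnorm_rep_star; exact: rep_norm_ub.
Qed.

Lemma rep_norm1 : rep_norm 1 != 0.
Proof.
have [H [rho h]] := nt; rewrite gt_eqF //.
by apply: lt_le_trans (rep_norm_ub 1 rho); rewrite lt0r h opnorm_rep_ge0.
Qed.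

Definition enveloping_seminorm : cstarSeminorm A :=
  CStarSeminorm rep_normD rep_normZ rep_normM rep_norm_star rep_norm1.

End Enveloping.

(* R[i] as a one-dimensional Hilbert space; it shows that the set of
   representations considered below is not empty. *)
Section OneDimensional.
Variable R : realType.

Definition C1 : Type := R[i]^o.
HB.instance Definition _ := NormedModule.copy C1 R[i]^o.

Lemma normc_le_ReIm (z : R[i]) :
  `|z| <= (`|complex.Re z| + `|complex.Im z|)%:C.
Proof.
rewrite {1}(complexE z); apply: le_trans (ler_normD _ _) _.
have nR (x : R) : `|x%:C| = `|x|%:C :> R[i].
  by rewrite normc_def /= expr0n /= addr0 sqrtr_sqr.
have ni : `|'i : R[i]| = 1.
  by rewrite normc_def /= expr0n /= add0r expr1n sqrtr1.
by rewrite normrM !nR ni mul1r rmorphD.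
Qed.

Lemma normc_ge_Im (z : R[i]) : `|complex.Im z|%:C <= `|z|.
Proof.
rewrite normc_def lecR -sqrtr_sqr ler_wsqrtr // lerDr sqr_ge0 //.
Qed.

Lemma C1_Re_dist (x y : C1) :
  `|complex.Re (x : R[i]) - complex.Re (y : R[i])|%:C <= `|x - y|.
Proof. by case: x y => [a b] [c d]; exact: (normc_ge_Re ((a - c) +i* (b - d))). Qed.

Lemma C1_Im_dist (x y : C1) :
  `|complex.Im (x : R[i]) - complex.Im (y : R[i])|%:C <= `|x - y|.
Proof. by case: x y => [a b] [c d]; exact: (normc_ge_Im ((a - c) +i* (b - d))). Qed.

Lemma C1_dist (x y : C1) : `|x - y| <=
  (`|complex.Re (x : R[i]) - complex.Re (y : R[i])| +
   `|complex.Im (x : R[i]) - complex.Im (y : R[i])|)%:C.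
Proof. by case: x y => [a b] [c d]; exact: (normc_le_ReIm ((a - c) +i* (b - d))). Qed.

Lemma C1_complete (F : set_system C1) : ProperFilter F -> cauchy F -> cvg F.
Proof.
move=> FF /cauchyP Fc.
have ex (e : R) : 0 < e -> exists x : C1, \forall y \near F, `|x - y| < e%:C.
  move=> e0; have [|x hx] := Fc (e%:C); first by rewrite ltcR.
  by exists x; move: hx; rewrite -ball_normE.
have cRe : cvg ((fun z : C1 => complex.Re (z : R[i])) @ F).
  apply: R_complete; apply: cauchy_exP => e /ex [x hx].
  exists (complex.Re (x : R[i])); rewrite /nbhs /=; near=> y.
  rewrite -ball_normE /= -ltcR; apply: le_lt_trans (C1_Re_dist _ _) _.
  by near: y.
have cIm : cvg ((fun z : C1 => complex.Im (z : R[i])) @ F).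
  apply: R_complete; apply: cauchy_exP => e /ex [x hx].
  exists (complex.Im (x : R[i])); rewrite /nbhs /=; near=> y.
  rewrite -ball_normE /= -ltcR; apply: le_lt_trans (C1_Im_dist _ _) _.
  by near: y.
have [a ha] := (cvg_ex _).1 cRe; have [b hb] := (cvg_ex _).1 cIm.
apply/cvg_ex; exists ((a +i* b) : C1); apply/cvgrPdist_lt => e e0.
have er : e = (complex.Re e)%:C by rewrite RRe_real // gtr0_real.
have e2 : 0 < complex.Re e / 2 by rewrite divr_gt0 // -ltcR -er.
move/cvgrPdist_lt : ha => /(_ _ e2) ha; move/cvgrPdist_lt : hb => /(_ _ e2) hb.
near=> y; apply: le_lt_trans (C1_dist _ _) _ => /=.
rewrite er ltcR (splitr (complex.Re e)); apply: ltrD; near: y.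
  exact: ha.
exact: hb.
Unshelve. all: by end_near. Qed.

HB.instance Definition _ := Uniform_isComplete.Build C1 C1_complete.

Definition C1dot (u v : C1) : R[i] := (u : R[i]) * Num.conj (v : R[i]).

Lemma C1dot_bilinear : bilinear_for ( *%R : GRing.Scale.law R[i] R[i])
  (Num.conj \; *%R : GRing.Scale.law R[i] R[i]) C1dot.
Proof.
split=> [u|u] k x y; rewrite /C1dot.
  by rewrite mulrDl -mulrA.
by rewrite rmorphD rmorphM mulrDr mulrCA.
Qed.

HB.instance Definition _ := bilinear_isBilinear.Build R[i] C1 C1 R[i]
  _ _ C1dot C1dot_bilinear.

Lemma C1dot_herm x y : C1dot x y = (-1) ^+ false * Num.conj (C1dot y x).
Proof.
rewrite expr0 mul1r /C1dot [RHS](rmorphM Num.conj (y : R[i])) mulrC; congr (_ * _).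
exact/esym/(@conjCK R[i]).
Qed.

HB.instance Definition _ := isHermitianSesquilinear.Build R[i] C1 false
  (@Num.conj R[i]) C1dot C1dot_herm.

Lemma C1dot_gt0 u : u != 0 -> 0 < C1dot u u.
Proof. by move=> u0; rewrite /C1dot -normCK exprn_gt0 // normr_gt0. Qed.

HB.instance Definition _ := isDotProduct.Build R[i] C1 C1dot C1dot_gt0.

HB.instance Definition _ :=
  @isHilbert.Build R C1 (C1dot : {dot C1 for @Num.conj R[i]}) (fun v => normCK v).

End OneDimensional.

Section Norm.
Variables (R : realType) (p q : R).

Section TrivialRep.
Variable chi : {lrmorphism OS3pq p q -> R[i]^o}.
Hypothesis chi_star : {morph chi : x / star x >-> star x}.

Definition chi_fun (x : OS3pq p q) (v : C1 R) : C1 R := (chi x : R[i]) *: v.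

Lemma chi_fun_linear x : linear (chi_fun x).
Proof. by move=> k u v; rewrite /chi_fun scalerDr !scalerA mulrC. Qed.

HB.instance Definition _ x :=
  GRing.isLinear.Build R[i] (C1 R) (C1 R) _ (chi_fun x) (chi_fun_linear x).

Definition chi_lin (x : OS3pq p q) : {linear C1 R -> C1 R} := chi_fun x.

Lemma chi_fun_continuous x : continuous (chi_lin x).
Proof. exact: scaler_continuous. Qed.

Lemma chi_funD x y v : chi_lin (x + y) v = chi_lin x v + chi_lin y v.
Proof. by rewrite /= /chi_fun raddfD scalerDl. Qed.

Lemma chi_funZ (k : R[i]) x v : chi_lin (k *: x) v = k *: chi_lin x v.
Proof. by rewrite /= /chi_fun linearZ scalerA. Qed.

Lemma chi_fun1 v : chi_lin 1 v = v.
Proof. by rewrite /= /chi_fun rmorph1 scale1r. Qed.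

Lemma chi_funM x y v : chi_lin (x * y) v = chi_lin x (chi_lin y v).
Proof. by rewrite /= /chi_fun rmorphM scalerA. Qed.

Lemma chi_fun_star x v w : hdot (chi_lin (star x) v) w = hdot v (chi_lin x w).
Proof.
rewrite /= /chi_fun chi_star linearZl_LR linearZr_LR /=.
by [].
Qed.

Definition chi_rep : starRep (OS3pq p q) (C1 R) := StarRep chi_fun_continuous
  chi_funD chi_funZ chi_fun1 chi_funM chi_fun_star.

Lemma chi_rep1 : opnorm (chi_rep 1) != 0.
Proof.
apply/eqP => h; have := opnormP (rep_bounded chi_rep 1) ((1 : R[i]) : C1 R).
have n1 : hnorm ((1 : R[i]) : C1 R) = 1 by apply: complexI; rewrite -normhE normr1.
by rewrite h mul0r [X in hnorm X]chi_fun1 n1 ler10.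
Qed.

End TrivialRep.

Lemma OS3pq_rep_ex : exists (H : hilbertType R) (rho : starRep (OS3pq p q) H),
  opnorm (rho 1) != 0.
Proof.
have [chi [chi_star _ _]] := OS3pq_lift_ex (S3pq_rel11 p q).
by exists (C1 R), (chi_rep chi_star); exact: chi_rep1.
Qed.

Hypotheses (p01 : 0 < p < 1) (q01 : 0 < q < 1).

Lemma opnorm_gen_le1 (A : starAlgType R) (H : hilbertType R) (rho : starRep A H)
    (x : A) (t : R) : 0 < t < 1 ->
  star x * x - t%:C *: (x * star x) = (1 - t)%:C *: 1 -> opnorm (rho x) <= 1.
Proof.
move=> /andP[t0 t1] h.
have n0 := opnorm_rep_ge0 rho x.
have k (s : R) : 0 <= s -> complex.Re `|s%:C : R[i]| = s.
  by move=> s0; rewrite ger0_norm // ler0c.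
have E : opnorm (rho x) ^+ 2 <= (1 - t) + t * opnorm (rho x) ^+ 2.
  rewrite -{1}opnorm_rep_star -[star x * x](subrK (t%:C *: (x * star x))) h.
  apply: le_trans (opnorm_repD _ _ _) _; apply: lerD.
    apply: le_trans (opnorm_repZ_le _ _ _) _.
    have t1' : 0 <= 1 - t by rewrite subr_ge0 ltW.
    by rewrite k // -[leRHS]mulr1 ler_wpM2l // opnorm_rep1.
  apply: le_trans (opnorm_repZ_le _ _ _) _; rewrite (k _ (ltW t0)).
  apply: ler_wpM2l; first exact: ltW.
  rewrite expr2; apply: le_trans (opnorm_repM _ _ _) _.
  by rewrite ler_wpM2l // opnorm_rep_adj.
have : (1 - t) * opnorm (rho x) ^+ 2 <= (1 - t) * 1 by nra.
rewrite ler_pM2l ?subr_gt0 // => n1.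
by rewrite -(@ler_pXn2r _ 2) ?nnegrE // expr1n.
Qed.

Fixpoint sbound (t : sterm R) : R :=
  match t with
  | SA | SB | SOne => 1
  | SZero => 0
  | SAdd x y => sbound x + sbound y
  | SOpp x => sbound x
  | SMul x y => sbound x * sbound y
  | SScale k x => complex.Re `|k| * sbound x
  | SStar x => sbound x
  end.

Lemma OS3pq_rep_bounded (x : OS3pq p q) : has_ubound (rep_norms x).
Proof.
elim/pquotW: x => t; exists (sbound t) => r [H [rho ->]].
have [ra rb _ _ _] := @OS3pq_rel R p q.
have g := opnorm_rep_ge0 rho.
rewrite -seval_gen; elim: t => /= [||||x hx y hy|x hx|x hx y hy|k x hx|x hx].
- exact: opnorm_gen_le1 q01 ra.
- exact: opnorm_gen_le1 p01 rb.
- exact: opnorm_rep0.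
- exact: opnorm_rep1.
- by apply: le_trans (opnorm_repD _ _ _) _; exact: lerD.
- rewrite -scaleN1r; apply: le_trans (opnorm_repZ_le _ _ _) _.
  by rewrite normrN1 mul1r.
- by apply: le_trans (opnorm_repM _ _ _) _; exact: ler_pM.
- apply: le_trans (opnorm_repZ_le _ _ _) _; apply: ler_wpM2l => //.
  by rewrite -ler0c RRe_real ?normr_real.
- by apply: le_trans (opnorm_rep_adj _ _) _.
Qed.

Definition S3pq_seminorm : cstarSeminorm (OS3pq p q) :=
  enveloping_seminorm OS3pq_rep_bounded OS3pq_rep_ex.

(* The enveloping C*-algebra.  The type depends on the bounds on p and q because
   they make the supremum rep_norm finite (each generator has norm at most 1
   in every representation). *)
Definition CS3pq : Type := completion S3pq_seminorm.
HB.instance Definition _ := CStarAlgebra.on CS3pq.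

Definition OS3pq_to_CS3pq : OS3pq p q -> CS3pq := completion_emb S3pq_seminorm.
HB.instance Definition _ := GRing.LRMorphism.on OS3pq_to_CS3pq.

Lemma OS3pq_to_CS3pq_norm (x : OS3pq p q) :
  cnorm (OS3pq_to_CS3pq x) = rep_norm x.
Proof. exact: completion_emb_norm. Qed.

End Norm.

Section Basis.
Variables (K : pzRingType) (V : lmodType K) (I : eqType).

Definition lin_indep (f : I -> V) := forall (s : seq I) (c : I -> K),
  uniq s -> \sum_(i <- s) c i *: f i = 0 -> forall i, i \in s -> c i = 0.

Definition generates (f : I -> V) := forall v : V,
  exists (s : seq I) (c : I -> K), v = \sum_(i <- s) c i *: f i.

Definition vs_basis (f : I -> V) := lin_indep f /\ generates f.

End Basis.

Definition star_pow (R : realType) (A : starAlgType R) (x : A) (mu : int) : A :=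
  if 0 <= mu then x ^+ `|mu|%N else star x ^+ `|mu|%N.

(* Tuples t = (mu, nu, (m, n)) with m * n = 0. *)
Definition S3pq_index :=
  {t : int * int * (nat * nat) | (t.2.1 * t.2.2 == 0)%N}.

Definition S3pq_monomial (R : realType) (p q : R) (t : S3pq_index) : OS3pq p q :=
  let: (mu, nu, (m, n)) := val t in
  let a := gena p q in let b := genb p q in
  star_pow a mu * (1 - a * star a) ^+ m * (1 - b * star b) ^+ n * star_pow b nu.

(* Main.v *)
(* The algebra acts on l^2(N) by (a, b) |-> (S_q, z) and (a, b) |-> (z, S_p),
   where |z| = 1 and S_t e_k = sqrt(1 - t^(k+1)) e_(k+1).  Since 1 - S_t S_t^*
   is diagonal with entries t^k, and 1 - z z^* = 0, the matrix coefficient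
   <x e_k, e_l> of a combination x of monomials in the first representation is
   a nonzero multiple of sum c z^nu q^(k m), over the monomials with n = 0 and
   k + mu = l.  If it vanishes for all z on the circle and all large k, then so
   does each coefficient of this Laurent polynomial in z, hence each
   coefficient of the remaining polynomial in q^k; the second representation
   handles m = 0.  So a combination of monomials that is killed by these
   representations is trivial, which gives independence, and injectivity once
   the monomials are known to span. *)
Require Import Defs.
From HB Require Import structures.
From mathcomp Require Import all_boot all_order all_algebra.
From mathcomp Require Import complex sesquilinear.
From mathcomp Require Import ring lra zify.
From mathcomp Require Import all_classical all_reals all_analysis.

Set Implicit Arguments.
Unset Strict Implicit.
Unset Printing Implicit Defensive.

Import Order.TTheory GRing.Theory Num.Theory.
Import numFieldNormedType.Exports.

Local Open Scope classical_set_scope.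
Local Open Scope ring_scope.
Local Open Scope complex_scope.

(** * The Hilbert space of square-summable sequences *)

Section DotNorm.
Variables (C : numClosedFieldType) (U : lmodType C).
Variable form : {dot U for @Num.conj C}.

(** Expand [0 <= form w w] at [w = d *: u - c *: v] with [d = form v v] and [c = form u v], then
    cancel the factor [d]. Stated for a bare dot product, because it is used to construct the norm
    of l2. *)
Lemma dot_cauchy_schwarz u v :
  `|form u v| <= sqrtC (form u u) * sqrtC (form v v).
Proof.
have [->|v0] := eqVneq v 0; first by rewrite !linear0r normr0 sqrtC0 mulr0.
have d0 : 0 < form v v by exact: neq0_dnorm_gt0.
have dc : Num.conj (form v v) = form v v by rewrite conj_Creal // gtr0_real.
set c := form u v; set d := form v v in d0 dc *.
have cc : form v u = Num.conj c by rewrite hermC expr0 mul1r.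
have : 0 <= form (d *: u - c *: v) (d *: u - c *: v) by exact: dnorm_ge0.
rewrite linearBl linearBr linearBr !linearZl_LR /= !linearZr_LR /= -/c -/d cc dc.
rewrite [X in 0 <= X](_ : _ = d * (d * form u u - `|c| ^+ 2)); last first.
  by rewrite normCK /GRing.scale /=; ring.
rewrite pmulr_rge0 // subr_ge0 => h.
rewrite -(@ler_pXn2r _ 2) ?nnegrE ?normr_ge0 ?mulr_ge0 ?sqrt_dnorm_ge0 //.
by rewrite exprMn !sqrtCK mulrC.
Qed.

Lemma dot_triangle u v :
  sqrtC (form (u + v) (u + v)) <= sqrtC (form u u) + sqrtC (form v v).
Proof.
have s w := sqrt_dnorm_ge0 form w.
rewrite -(@ler_pXn2r _ 2) ?nnegrE ?addr_ge0 // sqrrD !sqrtCK dnormD.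
rewrite addrAC lerD2r lerD2l.
have -> : form u v + Num.conj (form u v) = 'Re (form u v) *+ 2.
  by rewrite ReE -mulr_natr divfK // pnatr_eq0.
rewrite lerMn2r /=.
exact: le_trans (leif_Re_Creal _) (dot_cauchy_schwarz _ _).
Qed.

Lemma sqrt_dnormZ k u :
  sqrtC (form (k *: u) (k *: u)) = `|k| * sqrtC (form u u).
Proof.
by rewrite dnormZ rootCMl ?exprn_ge0 // sqrCK.
Qed.

Lemma sqrt_dnorm0_eq0 u : sqrtC (form u u) = 0 -> u = 0.
Proof. by move/eqP; rewrite sqrt_dnorm_eq0 => /eqP. Qed.

End DotNorm.

(** * Complex series through their real and imaginary parts *)

Section ComplexSeries.
Variable R : realType.
Implicit Types (f g : nat -> R[i]) (z w : R[i]).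

Definition csummable f := cvgn (series (fun i => complex.Re (f i)))
  /\ cvgn (series (fun i => complex.Im (f i))).

Definition csum f : R[i] := limn (series (fun i => complex.Re (f i)))
  +i* limn (series (fun i => complex.Im (f i))).

Lemma eq_csum f g : f =1 g -> csum f = csum g.
Proof. by move=> /funext ->. Qed.

Lemma csumD f g : csummable f -> csummable g ->
  csummable (fun i => f i + g i) /\ csum (fun i => f i + g i) = csum f + csum g.
Proof.
move=> [fr fi] [gr gi]; rewrite /csummable /csum.
have -> : (fun i => complex.Re (f i + g i)) =
  (fun i => complex.Re (f i)) + (fun i => complex.Re (g i)).
  by apply/funext => i; rewrite raddfD.
have -> : (fun i => complex.Im (f i + g i)) =
  (fun i => complex.Im (f i)) + (fun i => complex.Im (g i)).
  by apply/funext => i; rewrite raddfD.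
by split; [split; exact: is_cvg_seriesD|rewrite !lim_seriesD].
Qed.

Lemma csumZ z f : csummable f ->
  csummable (fun i => z * f i) /\ csum (fun i => z * f i) = z * csum f.
Proof.
move=> [fr fi]; rewrite /csummable /csum; case: z => a b.
have -> : (fun i => complex.Re ((a +i* b) * f i)) =
  a *: (fun i => complex.Re (f i)) - b *: (fun i => complex.Im (f i)).
  by apply/funext => i; rewrite !fctE; case: (f i).
have -> : (fun i => complex.Im ((a +i* b) * f i)) =
  a *: (fun i => complex.Im (f i)) + b *: (fun i => complex.Re (f i)).
  by apply/funext => i; rewrite !fctE; case: (f i).
split; first by split; [apply: is_cvg_seriesB|apply: is_cvg_seriesD];
  apply: is_cvg_seriesZ.
rewrite lim_seriesB ?lim_seriesD; try by apply: is_cvg_seriesZ.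
by rewrite !lim_seriesZ.
Qed.

Lemma csum_conj f : csummable f -> csum (fun i => Num.conj (f i)) = Num.conj (csum f).
Proof.
move=> [fr fi]; rewrite /csum.
have -> : (fun i => complex.Re (Num.conj (f i)) ) = (fun i => complex.Re (f i)).
  apply/funext => i; rewrite ?fctE; case: (f i) => a b.
  by rewrite -[Num.conj _]/(conjc _).
have -> : (fun i => complex.Im (Num.conj (f i)) ) = - (fun i => complex.Im (f i)).
  apply/funext => i; rewrite ?fctE; case: (f i) => a b.
  by rewrite -[Num.conj _]/(conjc _).
by rewrite lim_seriesN.
Qed.

(** The squared modulus, valued in [R] rather than [R[i]] so that the convergence theorems for real
    series apply. *)
Definition sqn z : R := complex.Re z ^+ 2 + complex.Im z ^+ 2.

Lemma sqn_ge0 z : 0 <= sqn z.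
Proof. by rewrite addr_ge0 ?sqr_ge0. Qed.

Lemma sqn_eq0 z : sqn z = 0 -> z = 0.
Proof.
case: z => a b /eqP; rewrite paddr_eq0 ?sqr_ge0 // !sqrf_eq0 /=.
by move=> /andP[/eqP -> /eqP ->].
Qed.

Lemma sqnM z w : sqn (z * w) = sqn z * sqn w.
Proof. by case: z w => [a b] [c d]; rewrite /sqn /=; ring. Qed.

Lemma sqnD z w : sqn (z + w) <= 2 * (sqn z + sqn w).
Proof.
case: z w => [a b] [c d]; rewrite /sqn /=.
have := sqr_ge0 (a - c); have := sqr_ge0 (b - d); nra.
Qed.

Lemma mul_conjE z : z * Num.conj z = (sqn z)%:C.
Proof.
case: z => a b; apply/eqP; rewrite eq_complex /sqn /=.
by apply/andP; split; apply/eqP; ring.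
Qed.

Lemma csummable_le f (g : nat -> R) : cvgn (series g) ->
  (forall i, `|complex.Re (f i)| <= g i) ->
  (forall i, `|complex.Im (f i)| <= g i) -> csummable f.
Proof.
have h (u : nat -> R) : cvgn (series g) -> (forall i, `|u i| <= g i) ->
    cvgn (series u).
  move=> gc ug; apply: normed_cvg; apply: (series_le_cvg _ _ ug gc) => // i.
  exact: le_trans (ug i).
by move=> gc fr fi; split; apply: h.
Qed.

End ComplexSeries.

(** * The module l2 of square-summable sequences *)

Section L2.
Variable R : realType.

Definition l2_pred : {pred (nat -> R[i])} :=
  fun u => `[< cvgn (series (fun i => sqn (u i))) >].

Lemma l2_closed : submod_closed l2_pred.
Proof.
split.
  apply/asboolP; rewrite [X in series X](_ : _ = (fun=> 0)).
    have -> : series (fun _ : nat => (0 : R)) = (fun=> 0).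
      by apply/funext => n; rewrite /series /= big1.
    exact: is_cvg_cst.
  by apply/funext => i; rewrite /sqn /= expr0n addr0.
move=> k u v /asboolP uc /asboolP vc; apply/asboolP.
apply: (@series_le_cvg _ _ (2 *: (sqn k *: (fun i => sqn (u i)) +
  (fun i => sqn (v i))))) => [i|i|i|].
- exact: sqn_ge0.
- by rewrite mulr_ge0 // addr_ge0 ?mulr_ge0 ?sqn_ge0.
- by apply: le_trans (sqnD _ _) _; rewrite sqnM.
- apply: is_cvg_seriesZ; apply: is_cvg_seriesD => //.
  exact: is_cvg_seriesZ.
Qed.

HB.instance Definition _ :=
  GRing.isSubmodClosed.Build R[i] (nat -> R[i]) l2_pred l2_closed.

Record l2 := L2 { l2val :> nat -> R[i]; _ : l2_pred l2val }.

HB.instance Definition _ := [isSub for l2val].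
HB.instance Definition _ := gen_eqMixin l2.
HB.instance Definition _ := gen_choiceMixin l2.
HB.instance Definition _ := [SubChoice_isSubLmodule of l2 by <:].

End L2.

(** * Inner product and norm of l2 *)

Section L2Dot.
Variable R : realType.
Implicit Types u v w : l2 R.

Lemma l2_cvg u : cvgn (series (fun i => sqn (u i))).
Proof. by case: u => u /= /asboolP. Qed.

Lemma l2P u v : (forall i, u i = v i) -> u = v.
Proof. by move=> h; apply/val_inj/funext. Qed.

Lemma l2DE u v i : (u + v) i = u i + v i. Proof. by []. Qed.
Lemma l2ZE k u i : (k *: u) i = k * u i. Proof. by []. Qed.
Lemma l20E i : (0 : l2 R) i = 0. Proof. by []. Qed.

(** Absolute convergence by comparison: both parts of each product are at most
    [sqn (u i) + sqn (v i)], by positivity of squares of sums and differences. *)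
Lemma l2_csummable u v : csummable (fun i => u i * Num.conj (v i)).
Proof.
apply: (@csummable_le _ _ ((fun i => sqn (u i)) + (fun i => sqn (v i)))).
- by apply: is_cvg_seriesD; exact: l2_cvg.
- move=> i; rewrite fctE; case: (u i) (v i) => [a b] [c d].
  rewrite -[Num.conj _]/(conjc _) /sqn /= ler_norml; apply/andP; split.
    by have := sqr_ge0 (a + c); have := sqr_ge0 (b + d); nra.
  by have := sqr_ge0 (a - c); have := sqr_ge0 (b - d); nra.
- move=> i; rewrite fctE; case: (u i) (v i) => [a b] [c d].
  rewrite -[Num.conj _]/(conjc _) /sqn /= ler_norml; apply/andP; split.
    by have := sqr_ge0 (a - d); have := sqr_ge0 (b + c); nra.
  by have := sqr_ge0 (a + d); have := sqr_ge0 (b - c); nra.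
Qed.

Definition l2dot u v : R[i] := csum (fun i => u i * Num.conj (v i)).

Lemma l2dot_bilinear : bilinear_for ( *%R : GRing.Scale.law R[i] R[i])
  (Num.conj \; *%R : GRing.Scale.law R[i] R[i]) l2dot.
Proof.
split=> [w|w] k u v; rewrite /l2dot /=.
  have [cs <-] := csumZ k (l2_csummable u w).
  have [_ <-] := csumD cs (l2_csummable v w).
  by apply: eq_csum => i; rewrite -[LHS]/((k * u i + v i) * _) mulrDl mulrA.
have [cs <-] := csumZ (Num.conj k) (l2_csummable w u).
have [_ <-] := csumD cs (l2_csummable w v).
apply: eq_csum => i.
rewrite -[LHS]/(_ * Num.conj (k * u i + v i)) rmorphD rmorphM mulrDr.
by rewrite mulrCA.
Qed.

HB.instance Definition _ := bilinear_isBilinear.Build R[i] (l2 R) (l2 R) R[i]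
  _ _ l2dot l2dot_bilinear.

Lemma l2dot_herm u v : l2dot u v = (-1) ^+ false * Num.conj (l2dot v u).
Proof.
rewrite expr0 mul1r /l2dot -(csum_conj (l2_csummable _ _)).
apply: eq_csum => i; rewrite [RHS](rmorphM Num.conj) mulrC; congr (_ * _).
exact/esym/(@conjCK R[i]).
Qed.

HB.instance Definition _ := isHermitianSesquilinear.Build R[i] (l2 R) false
  (@Num.conj R[i]) l2dot l2dot_herm.

Lemma l2dot_sqn u : l2dot u u = (limn (series (fun i => sqn (u i))))%:C.
Proof.
rewrite /l2dot /csum; under eq_fun do rewrite mul_conjE /=.
under [X in _ +i* limn (series X)]eq_fun do rewrite mul_conjE /=.
congr (_ +i* _).
have -> : series (fun _ : nat => (0 : R)) = (fun=> 0).
  by apply/funext => n; rewrite /series /= big1.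
exact: lim_cst.
Qed.

Lemma l2_partial_le u n :
  series (fun i => sqn (u i)) n <= limn (series (fun i => sqn (u i))).
Proof.
apply: nondecreasing_cvgn_le; last exact: l2_cvg.
by apply: nondecreasing_series => i _ _; exact: sqn_ge0.
Qed.

Lemma l2_coord_le u i : sqn (u i) <= limn (series (fun j => sqn (u j))).
Proof.
apply: le_trans (l2_partial_le u i.+1).
rewrite /series /= big_nat_recr //= lerDr.
by apply: sumr_ge0 => j _; exact: sqn_ge0.
Qed.

Lemma l2dot_gt0 u : u != 0 -> 0 < l2dot u u.
Proof.
move=> u0; rewrite l2dot_sqn ltcR lt_neqAle andbC.
rewrite (le_trans (sqn_ge0 _) (l2_coord_le u 0)) /=.
apply: contra u0 => /eqP h; apply/eqP/l2P => i; apply: sqn_eq0.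
by apply/eqP; rewrite eq_le sqn_ge0 h l2_coord_le.
Qed.

HB.instance Definition _ := isDotProduct.Build R[i] (l2 R) l2dot l2dot_gt0.

Let dot : {dot l2 R for @Num.conj R[i]} := l2dot.

HB.instance Definition _ := Lmodule_isNormed.Build R[i] (l2 R)
  (dot_triangle dot) (sqrt_dnormZ dot) (@sqrt_dnorm0_eq0 _ _ dot).

Lemma l2_norm2 u : `|u| ^+ 2 = l2dot u u.
Proof. exact: (sqrtCK (l2dot u u)). Qed.

Lemma l2_norm_le u (e : R) : 0 <= e ->
  limn (series (fun i => sqn (u i))) <= e ^+ 2 -> `|u| <= e%:C.
Proof.
move=> e0 h; rewrite -(@ler_pXn2r _ 2) ?nnegrE ?normr_ge0 ?ler0c //.
by rewrite l2_norm2 l2dot_sqn -rmorphXn lecR.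
Qed.

End L2Dot.

(** * Completeness of l2 *)

Section L2Complete.
Variable R : realType.
Implicit Types u v w : l2 R.

Lemma l2_series_le u (e : R) : 0 <= e -> `|u| <= e%:C ->
  forall n, series (fun i => sqn (u i)) n <= e ^+ 2.
Proof.
move=> e0 ue n; apply: le_trans (l2_partial_le u n) _.
rewrite -lecR -l2dot_sqn -l2_norm2 rmorphXn ler_pXn2r ?nnegrE //.
by rewrite ler0c.
Qed.

Lemma l2_coord_Re u i : `|complex.Re (u i)|%:C <= `|u|.
Proof.
rewrite -(@ler_pXn2r _ 2) ?nnegrE ?normr_ge0 ?ler0c // l2_norm2 l2dot_sqn.
rewrite -rmorphXn lecR; apply: le_trans (l2_coord_le u i).
by rewrite real_normK ?num_real // lerDl sqr_ge0.
Qed.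

Lemma l2_coord_Im u i : `|complex.Im (u i)|%:C <= `|u|.
Proof.
rewrite -(@ler_pXn2r _ 2) ?nnegrE ?normr_ge0 ?ler0c // l2_norm2 l2dot_sqn.
rewrite -rmorphXn lecR; apply: le_trans (l2_coord_le u i).
by rewrite real_normK ?num_real // lerDr sqr_ge0.
Qed.

(** Partial sums of squared moduli are nondecreasing, so a uniform bound gives convergence.
    Membership of limits, basis vectors and shifted sequences is proved this way. *)
Lemma l2_pred_bounded (x : nat -> R[i]) (M : R) :
  (forall n, series (fun i => sqn (x i)) n <= M) ->
  l2_pred x /\ limn (series (fun i => sqn (x i))) <= M.
Proof.
move=> h; have c : cvgn (series (fun i => sqn (x i))).
  apply: nondecreasing_is_cvgn.
    by apply: nondecreasing_series => i _ _; exact: sqn_ge0.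
  by exists M => _ [n _ <-].
split; first exact/asboolP.
by apply: limr_le => //; exact: nearW.
Qed.

(** Coordinates form real Cauchy filters, which gives a coordinatewise limit [x]. The Cauchy bound
    on each partial sum passes to [x], uniformly in the length of the sum, so [x] is in l2 and is
    the limit in norm. *)
Lemma l2_complete (F : set_system (l2 R)) : ProperFilter F -> cauchy F -> cvg F.
Proof.
move=> FF /cauchyP Fc.
have ex (e : R) : 0 < e -> exists v, \forall u \near F, `|v - u| < e%:C.
  move=> e0; have [|v hv] := Fc (e%:C); first by rewrite ltcR.
  by exists v; move: hv; rewrite -ball_normE.
have coord (f : {additive R[i] -> R}) i : (forall v, `|f (v i)|%:C <= `|v|) ->
    cvg ((fun v : l2 R => f (v i)) @ F).
  move=> fle; apply: R_complete; apply: cauchy_exP => e /ex [v hv].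
  exists (f (v i)); rewrite /nbhs /=; near=> u.
  rewrite -ball_normE /= -raddfB -ltcR.
  apply: le_lt_trans (fle (v - u)) _.
  by near: u.
have cRe i := coord (@complex.Re R) i (l2_coord_Re^~ i).
have cIm i := coord (@complex.Im R) i (l2_coord_Im^~ i).
pose a i := lim ((fun u : l2 R => complex.Re (u i)) @ F).
pose b i := lim ((fun u : l2 R => complex.Im (u i)) @ F).
pose x i : R[i] := a i +i* b i.
(* For fixed [n] only finitely many coordinates are involved, so the partial sum converges along
   [F]. *)
have cs v n : (fun u : l2 R => series (fun i => sqn (v i - u i)) n) @ F -->
    series (fun i => sqn (v i - x i)) n.
  elim: n => [|n ih].
    rewrite /series /= big_geq //; under eq_fun do rewrite big_geq //.
    exact: cvg_cst.
  rewrite /series /= big_nat_recr //=.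
  under eq_fun do rewrite big_nat_recr //=.
  apply: cvgD; first exact: ih.
  rewrite /sqn [complex.Re _](raddfB (@complex.Re R)).
  rewrite [complex.Im _](raddfB (@complex.Im R)).
  under eq_fun do rewrite (raddfB (@complex.Re R)) (raddfB (@complex.Im R)) !expr2.
  rewrite !expr2.
  by apply: cvgD; apply: cvgM; apply: cvgB => //; exact: cvg_cst.
have main (e : R) : 0 < e -> exists2 v, \forall u \near F, `|v - u| < e%:C &
    forall n, series (fun i => sqn (v i - x i)) n <= e ^+ 2.
  move=> e0; have [v hv] := ex e e0; exists v => // n.
  apply: (ler_cvg_to (cs v n) (cvg_cst (e ^+ 2))).
  near=> u; apply: (@l2_series_le (v - u)); first exact: ltW.
  by apply: ltW; near: u.
have xl2 : l2_pred x.
  have [v _ /l2_pred_bounded [vx _]] := main 1 ltr01.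
  (* [v - x] has bounded partial sums, hence lies in l2, and so does [x]. *)
  have -> : x = (v : nat -> R[i]) - ((v : nat -> R[i]) - x) by rewrite opprB addrC subrK.
  apply: rpredB => //; exact: (valP v).
apply/cvg_ex; exists (L2 xl2); apply/cvgrPdist_lt => e e0.
have er : e = (complex.Re e)%:C by rewrite RRe_real // gtr0_real.
have e2 : 0 < complex.Re e / 2 by rewrite divr_gt0 // -ltcR -er.
have [v hv hx] := main _ e2.
near=> u.
rewrite -(subrK v (L2 xl2)) -addrA er (splitr (complex.Re e)) rmorphD.
apply: le_lt_trans (ler_normD _ _) _; apply: ler_ltD; last by near: u.
rewrite distrC; apply: l2_norm_le; first exact: ltW.
by have [_] := l2_pred_bounded hx.
Unshelve. all: by end_near. Qed.

HB.instance Definition _ := Uniform_isComplete.Build (l2 R) l2_complete.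

HB.instance Definition _ :=
  @isHilbert.Build R (l2 R) (@l2dot R : {dot l2 R for @Num.conj R[i]})
    (@l2_norm2 R).

End L2Complete.

(** * Bounded operators with an adjoint *)

Section BoundedOperators.
Variables (R : realType) (H : hilbertType R).
Implicit Types (v w : H) (f g h : H -> H).

Definition adjoint_of f g := forall v w, hdot (g v) w = hdot v (f w).

Lemma hdot_inj v v' : (forall w, hdot v w = hdot v' w) -> v = v'.
Proof.
move=> h; apply/eqP; rewrite -subr_eq0; apply/eqP/hnorm_eq0/eqP.
rewrite -sqrf_eq0; apply/eqP/complexI; rewrite hnorm2 linearBl /= h.
by rewrite subrr.
Qed.

Lemma adjoint_sym f g : adjoint_of f g -> adjoint_of g f.
Proof. by move=> fg v w; rewrite hdotC -fg -hdotC. Qed.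

Lemma adjoint_linear f g : adjoint_of f g -> linear g.
Proof.
move=> fg k u v; apply: hdot_inj => w.
by rewrite fg linearDl linearZl_LR [in RHS]linearDl [in RHS]linearZl_LR /= !fg.
Qed.

(** The square of [hnorm (g v)] is the product of [v] with [f (g v)], at most
    [hnorm v * M * hnorm (g v)] by Cauchy-Schwarz; divide by [hnorm (g v)]. *)
Lemma adjoint_bound f g (M : R) : 0 <= M -> adjoint_of f g -> opbound f M ->
  opbound g M.
Proof.
move=> M0 fg fM v; have [->|gv] := eqVneq (hnorm (g v)) 0.
  by rewrite mulr_ge0 ?hnorm_ge0.
have {}gv : 0 < hnorm (g v) by rewrite lt0r gv hnorm_ge0.
rewrite -(ler_pM2r gv) -expr2 -lecR hnorm2 fg.
apply: le_trans (real_ler_norm _) _.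
  by rewrite -fg -hnorm2 ger0_real ?ler0c ?sqr_ge0.
apply: le_trans (cauchy_schwarz _ _) _; rewrite lecR (mulrC M) -mulrA.
by rewrite ler_wpM2l ?hnorm_ge0 ?fM.
Qed.

(** Having an adjoint forces linearity ([adjoint_linear]) and supplies the star operation. *)
Definition bop_pred : {pred (H -> H)} := fun f =>
  `[< (exists2 M : R, 0 <= M & opbound f M) /\ exists g, adjoint_of f g >].

Lemma bop_closed : submod_closed bop_pred.
Proof.
split.
  apply/asboolP; split.
    by exists 0 => // v; rewrite mul0r [X in hnorm X](_ : _ = 0) // hnorm0.
  by exists (fun=> 0) => v w; rewrite linear0l [X in hdot v X](_ : _ = 0) ?linear0r.
move=> k f g /asboolP[[M M0 fM] [f' ff']] /asboolP[[N N0 gN] [g' gg']].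
have k0 : 0 <= complex.Re `|k| by rewrite -ler0c RRe_real ?normr_real.
apply/asboolP; split.
  exists (complex.Re `|k| * M + N) => [|v]; first by rewrite addr_ge0 ?mulr_ge0.
  apply: le_trans (Defs.hnormD (k *: (f v : H)) (g v)) _.
  rewrite mulrDl lerD ?gN // hnormZ -mulrA.
  by rewrite ler_wpM2l.
exists (fun v => Num.conj k *: f' v + g' v) => v w.
rewrite -[X in hdot v X]/(k *: f w + g w).
by rewrite linearDl linearZl_LR linearDr linearZr_LR /= ff' gg'.
Qed.

HB.instance Definition _ :=
  GRing.isSubmodClosed.Build R[i] (H -> H) bop_pred bop_closed.

(* The parameter nt makes the ring of operators nontrivial. *)
Record bop (nt : exists v : H, v != 0) :=
  Bop { bopval :> H -> H; _ : bop_pred bopval }.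

Variable nt : exists v : H, v != 0.

HB.instance Definition _ := [isSub for @bopval nt].
HB.instance Definition _ := gen_eqMixin (bop nt).
HB.instance Definition _ := gen_choiceMixin (bop nt).
HB.instance Definition _ := [SubChoice_isSubLmodule of (bop nt) by <:].

Implicit Types S T U : bop nt.

Lemma bopP S T : (forall v, S v = T v) -> S = T.
Proof. by move=> h; apply/val_inj/funext. Qed.

Lemma bop_bounded S : exists2 M : R, 0 <= M & opbound S M.
Proof. by case: S => f /= /asboolP[]. Qed.

(** The adjoint is obtained by choice; [adj_uniq] shows that the choice does not matter. *)
Definition adj S : H -> H := let: Bop _ h := S in sval (cid (asboolW h).2).

Lemma adjP S : adjoint_of S (adj S).
Proof. by case: S => f h /=; exact: (svalP (cid _)). Qed.

Lemma bop_linear S : linear S.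
Proof. exact: adjoint_linear (adjoint_sym (adjP S)). Qed.

HB.instance Definition _ S :=
  GRing.isLinear.Build R[i] H H _ (S : H -> H) (bop_linear S).

Lemma bop_scale S k v : S (k *: v) = k *: S v.
Proof. exact: linearZ. Qed.

Lemma adj_uniq S g : adjoint_of S g -> g = adj S.
Proof.
by move=> Sg; apply/funext => v; apply: hdot_inj => w; rewrite Sg adjP.
Qed.

Lemma bop1_subproof : bop_pred idfun.
Proof.
apply/asboolP; split; last by exists idfun.
by exists 1 => // v; rewrite mul1r.
Qed.

Lemma bopM_subproof S T : bop_pred (S \o T).
Proof.
apply/asboolP; split; last first.
  by exists (adj T \o adj S) => v w /=; rewrite !adjP.
have [M M0 SM] := bop_bounded S; have [N N0 TN] := bop_bounded T.
exists (M * N) => [|v]; first exact: mulr_ge0.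
by apply: le_trans (SM _) _; rewrite -mulrA ler_wpM2l.
Qed.

Lemma bop_star_subproof S : bop_pred (adj S).
Proof.
apply/asboolP; split; last by exists S; exact: adjoint_sym (adjP S).
by have [M M0 SM] := bop_bounded S; exists M => //; exact: adjoint_bound (adjP S) _.
Qed.

Definition bop1 : bop nt := Bop _ bop1_subproof.
Definition bopM S T : bop nt := Bop _ (bopM_subproof S T).
Definition bop_star S : bop nt := Bop _ (bop_star_subproof S).

Lemma bopZE k S v : (k *: S) v = k *: S v. Proof. by []. Qed.

Lemma bop_mulA : associative bopM. Proof. by move=> S T U; apply: bopP. Qed.
Lemma bop_mul1l : left_id bop1 bopM. Proof. by move=> S; apply: bopP. Qed.
Lemma bop_mul1r : right_id bop1 bopM. Proof. by move=> S; apply: bopP. Qed.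
Lemma bop_mulDl : left_distributive bopM +%R.
Proof. by move=> S T U; apply: bopP. Qed.
Lemma bop_mulDr : right_distributive bopM +%R.
Proof. by move=> S T U; apply: bopP => v; exact: raddfD. Qed.
Lemma bop1_neq0 : bop1 != 0.
Proof.
have [v v0] := nt; apply: contra v0 => /eqP h.
by rewrite -[v]/(bop1 v) h.
Qed.

HB.instance Definition _ := GRing.Zmodule_isNzRing.Build (bop nt)
  bop_mulA bop_mul1l bop_mul1r bop_mulDl bop_mulDr bop1_neq0.

Lemma bopME S T v : (S * T) v = S (T v). Proof. by []. Qed.

Lemma bop_scaleAl k S T : k *: (S * T) = k *: S * T.
Proof. exact: bopP. Qed.
HB.instance Definition _ :=
  GRing.Lmodule_isLalgebra.Build R[i] (bop nt) bop_scaleAl.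

Lemma bop_scaleAr k S T : k *: (S * T) = S * (k *: T).
Proof. by apply: bopP => v; rewrite bopME bopZE linearZ. Qed.
HB.instance Definition _ :=
  GRing.Lalgebra_isAlgebra.Build R[i] (bop nt) bop_scaleAr.

Lemma bop_starE S g : adjoint_of S g -> bop_star S = g :> (H -> H).
Proof. by move=> /adj_uniq ->. Qed.

Lemma bop_starK : involutive bop_star.
Proof.
by move=> S; apply/val_inj/bop_starE; apply: adjoint_sym; exact: adjP.
Qed.

Lemma bop_starD : {morph bop_star : S T / S + T}.
Proof.
move=> S T; apply/val_inj/bop_starE => v w.
by rewrite /= linearDl linearDr /= !adjP.
Qed.

Lemma bop_starZ k S : bop_star (k *: S) = Num.conj k *: bop_star S.
Proof.
apply/val_inj/bop_starE => v w.
by rewrite bopZE linearZl_LR linearZr_LR /= adjP.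
Qed.

Lemma bop_starM S T : bop_star (S * T) = bop_star T * bop_star S.
Proof. by apply/val_inj/bop_starE => v w; rewrite /= !adjP. Qed.

HB.instance Definition _ := isStarAlgebra.Build R (bop nt)
  bop_starK bop_starD bop_starZ bop_starM.

Lemma bop_star_adj S v w : hdot (star S v) w = hdot v (S w).
Proof. exact: adjP. Qed.

Lemma bop_eq_star S g : adjoint_of S g -> star S = g :> (H -> H).
Proof. exact: bop_starE. Qed.

Lemma bop_continuous S : continuous S.
Proof.
apply/linear_bounded_continuous/linear_boundedP.
have [M M0 SM] := bop_bounded S.
near=> r => v; rewrite !normhE.
apply: le_trans (_ : (M * hnorm v)%:C <= _); first by rewrite lecR SM.
rewrite rmorphM ler_wpM2r ?ler0c ?hnorm_ge0 //.
by near: r; apply: nbhs_pinfty_ge; rewrite realE ler0c M0.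
Unshelve. all: by end_near. Qed.

Section Representation.
Variables (A : starAlgType R) (f : {lrmorphism A -> bop nt}).
Hypothesis f_star : {morph f : x / star x >-> star x}.

Definition bop_rep_fun (x : A) : {linear H -> H} := f x : H -> H.

(** Together with [OS3pq_lift_ex], this turns operators that satisfy the defining relations into a
    [starRep]. *)
Lemma bop_rep_ex : exists rho : starRep A H, forall x v, rho x v = f x v.
Proof.
unshelve eexists (@StarRep R A H bop_rep_fun _ _ _ _ _ _) => //.
- by move=> x; exact: bop_continuous.
- by move=> x y v; rewrite /bop_rep_fun /= raddfD.
- by move=> k x v; rewrite /bop_rep_fun /= linearZ.
- by move=> v; rewrite /bop_rep_fun /= rmorph1.
- by move=> x y v; rewrite /bop_rep_fun /= rmorphM.
- by move=> x v w; rewrite /bop_rep_fun /= f_star bop_star_adj.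
Qed.

End Representation.
End BoundedOperators.

(** * Weighted shifts *)

Section ShiftedSeries.
Variable R : realType.

Lemma lim_series_shift (f g : nat -> R) : g 0%N = 0 -> (forall i, g i.+1 = f i) ->
  cvgn (series f) -> limn (series g) = limn (series f).
Proof.
move=> g0 gS fc; apply/cvg_lim => //; rewrite -cvg_shiftS.
rewrite [X in X @ _](_ : _ = series f) //.
apply/funext => n; rewrite /series /= big_nat_recl //= g0 add0r.
by apply: eq_bigr => i _; exact: gS.
Qed.

(** Prepending a zero term does not change the sum; this is the source of adjointness between
    forward and backward shifts. *)
Lemma csum_shift (f g : nat -> R[i]) : g 0%N = 0 -> (forall i, g i.+1 = f i) ->
  csummable f -> csum g = csum f.
Proof.
move=> g0 gS [fr fi]; congr (_ +i* _); apply: lim_series_shift => //.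
- by rewrite g0.
- by move=> i; rewrite gS.
- by rewrite g0.
- by move=> i; rewrite gS.
Qed.

End ShiftedSeries.

Section L2Basis.
Variable R : realType.

Lemma l2_basis_subproof k : l2_pred (fun n => (n == k)%:R : R[i]).
Proof.
apply: (proj1 (@l2_pred_bounded R _ 1 _)) => n.
have -> : series (fun i => sqn ((i == k)%:R : R[i])) n = (k < n)%:R.
  elim: n => [|n ih]; first by rewrite /series /= big_geq.
  rewrite /series /= big_nat_recr //= [X in X + _]ih (ltnS k n).
  rewrite (leq_eqVlt k n) (eq_sym k n).
  rewrite /sqn; case: eqP => [->|_] /=; first by rewrite ltnn expr1n expr0n addr0 add0r.
  by rewrite expr0n !addr0.
by case: (k < n)%N.
Qed.

Definition l2_basis k : l2 R := L2 (l2_basis_subproof k).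

Lemma l2_nontrivial : exists v : l2 R, v != 0.
Proof.
exists (l2_basis 0); apply/eqP => /(congr1 (fun u : l2 R => u 0%N)) /eqP.
by rewrite /= oner_eq0.
Qed.

Definition l2op : Type := bop l2_nontrivial.
HB.instance Definition _ := StarAlgebra.on l2op.

End L2Basis.

Section WeightedShift.
Variables (R : realType) (s : nat -> R).
Hypothesis s01 : forall n, 0 <= s n <= 1.
Implicit Types u v w : l2 R.

Definition wshift_fun u n : R[i] := if n is m.+1 then (s m)%:C * u m else 0.
Definition wshift_adj_fun u n : R[i] := (s n)%:C * u n.+1.

Lemma sqn_weight n (z : R[i]) : sqn ((s n)%:C * z) <= sqn z.
Proof.
have /andP[s0 s1] := s01 n.
rewrite sqnM /sqn /= expr0n addr0 -[leRHS]mul1r ler_wpM2r ?addr_ge0 ?sqr_ge0 //.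
by rewrite expr_le1.
Qed.

(** Weights in [0, 1] only shrink terms. The bound gives both that the shifted sequence is in l2 and
    that the shift is a contraction. *)
Lemma wshift_series u n :
  series (fun i => sqn (wshift_fun u i)) n <= limn (series (fun i => sqn (u i))).
Proof.
case: n => [|n].
  by apply: le_trans (l2_partial_le u 0); rewrite /series /= !big_geq.
apply: le_trans (l2_partial_le u n); rewrite /series /= big_nat_recl //=.
rewrite {1}/sqn /= expr0n addr0 add0r; apply: ler_sum => i _.
exact: sqn_weight.
Qed.

Lemma wshift_adj_series u n :
  series (fun i => sqn (wshift_adj_fun u i)) n <= limn (series (fun i => sqn (u i))).
Proof.
apply: le_trans (l2_partial_le u n.+1); rewrite /series /= big_nat_recl //=.
rewrite -[leLHS]add0r lerD ?sqn_ge0 //; apply: ler_sum => i _.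
exact: sqn_weight.
Qed.

Definition wshift u : l2 R := L2 (l2_pred_bounded (wshift_series u)).1.
Definition wshift_adj u : l2 R := L2 (l2_pred_bounded (wshift_adj_series u)).1.

Lemma wshift_adjoint : adjoint_of wshift wshift_adj.
Proof.
move=> v w; rewrite -[LHS]/(csum _) -[RHS]/(csum _).
(* The right-hand series starts with a zero term; after dropping it the two series agree termwise,
   the weights being real. *)
rewrite [RHS](@csum_shift _ (fun i => wshift_adj v i * Num.conj (w i))) //=.
- by rewrite rmorph0 mulr0.
- move=> i; rewrite [in LHS]rmorphM /= /wshift_adj_fun mulrA; congr (_ * _).
  by rewrite mulrC; congr (_ * _); rewrite -[Num.conj _]/(conjc _) /= oppr0.
- exact: (l2_csummable (wshift_adj v) w).
Qed.

Lemma wshift_bop : bop_pred wshift.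
Proof.
apply/asboolP; split; last by exists wshift_adj; exact: wshift_adjoint.
exists 1 => // u; rewrite mul1r -lecR -!normhE -(@ler_pXn2r _ 2) ?nnegrE ?normr_ge0 //.
by rewrite !l2_norm2 !l2dot_sqn lecR (l2_pred_bounded (wshift_series u)).2.
Qed.

Definition wshift_op : l2op R := Bop (l2_nontrivial R) wshift_bop.

Lemma wshift_opE u n :
  wshift_op u n = if n is m.+1 then (s m)%:C * u m else 0.
Proof. by []. Qed.

Lemma wshift_starE u n : star wshift_op u n = (s n)%:C * u n.+1.
Proof. by rewrite (bop_eq_star (S := wshift_op) wshift_adjoint). Qed.

Lemma wshift_basis k : wshift_op (l2_basis R k) = (s k)%:C *: l2_basis R k.+1.
Proof.
apply: l2P => -[|n]; rewrite wshift_opE l2ZE /=; first by rewrite mulr0.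
by rewrite eqSS; case: eqP => [->|] //; rewrite !mulr0.
Qed.

Lemma wshift_star_basis k :
  star wshift_op (l2_basis R k.+1) = (s k)%:C *: l2_basis R k.
Proof.
apply: l2P => n; rewrite wshift_starE l2ZE /= eqSS.
by case: eqP => [->|] //; rewrite !mulr0.
Qed.

Lemma wshift_star_basis0 : star wshift_op (l2_basis R 0) = 0.
Proof. by apply: l2P => n; rewrite wshift_starE /= mulr0. Qed.

Hypothesis s_neq0 : forall n, s n != 0.

Lemma wshift_pow_basis j k : exists2 w : R[i], w != 0 &
  (wshift_op ^+ j) (l2_basis R k) = w *: l2_basis R (k + j)%N.
Proof.
elim: j => [|j [w w0 h]]; first by exists 1; rewrite ?oner_eq0 // addn0 scale1r.
exists (w * (s (k + j)%N)%:C).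
  by rewrite mulf_neq0 // fmorph_eq0.
by rewrite exprS bopME h bop_scale wshift_basis scalerA addnS.
Qed.

Lemma wshift_star_pow_basis j k : exists2 w : R[i], w != 0 &
  (star wshift_op ^+ j) (l2_basis R (k + j)%N) = w *: l2_basis R k.
Proof.
elim: j => [|j [w w0 h]]; first by exists 1; rewrite ?oner_eq0 // addn0 scale1r.
exists (w * (s (k + j)%N)%:C).
  by rewrite mulf_neq0 // fmorph_eq0.
by rewrite exprSr bopME addnS wshift_star_basis bop_scale h scalerA mulrC.
Qed.

Lemma wshift_star_pow_basis0 j k : (k < j)%N ->
  (star wshift_op ^+ j) (l2_basis R k) = 0.
Proof.
elim: j k => // j ih [|k]; rewrite ?ltnS => kj; rewrite exprSr bopME.
  by rewrite wshift_star_basis0 linear0.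
by rewrite wshift_star_basis bop_scale ih // scaler0.
Qed.

(** The operator sends the basis vector [k] to a nonzero multiple of the basis vector [k + mu], or
    to 0 if [k + mu] is negative. *)
Lemma wshift_star_pow_coord (mu : int) k l : exists2 w : R[i], w != 0 &
  star_pow wshift_op mu (l2_basis R k) l = if k%:Z + mu == l then w else 0.
Proof.
rewrite /star_pow; case: mu => j /=.
  have [w w0 h] := wshift_pow_basis j k; exists w => //; rewrite h l2ZE /=.
  by rewrite eq_sym -PoszD eqz_nat; case: eqP; rewrite ?mulr1 ?mulr0.
have [kj|jk] := ltnP k j.+1.
  (* Here [k + mu < 0] matches no natural [l], so any nonzero witness serves. *)
  exists 1; rewrite ?oner_eq0 // wshift_star_pow_basis0 //.
  by case: eqP => //; lia.
have [w w0 h] := wshift_star_pow_basis j.+1 (k - j.+1)%N; exists w => //.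
rewrite -{1}(subnK jk) h l2ZE /=.
have -> : (k%:Z + Negz j == l) = (l == k - j.+1)%N by apply/eqP/eqP; lia.
by case: eqP; rewrite ?mulr1 ?mulr0.
Qed.

End WeightedShift.

(** * The q-shift and its defect operator *)

Section QShift.
Variables (R : realType) (t : R).
Hypothesis t01 : 0 < t < 1.

Definition qweight n : R := Num.sqrt (1 - t ^+ n.+1).

Lemma qweight_gt0 n : 0 < 1 - t ^+ n.+1.
Proof. by have /andP[t0 t1] := t01; rewrite subr_gt0 exprn_ilt1 // ltW. Qed.

Lemma qweight01 n : 0 <= qweight n <= 1.
Proof.
have /andP[t0 t1] := t01.
by rewrite sqrtr_ge0 /= -sqrtr1 ler_wsqrtr // gerBl exprn_ge0 // ltW.
Qed.

Lemma qweight_neq0 n : qweight n != 0.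
Proof. by rewrite gt_eqF // sqrtr_gt0 qweight_gt0. Qed.

Lemma qweight_sqr n : (qweight n)%:C * (qweight n)%:C = (1 - t ^+ n.+1)%:C.
Proof. by rewrite -rmorphM -expr2 sqr_sqrtr // ltW // qweight_gt0. Qed.

Definition qshift : l2op R := wshift_op qweight01.

Lemma qshift0 v : qshift v 0%N = 0. Proof. by []. Qed.

Lemma qshiftS v n : qshift v n.+1 = (qweight n)%:C * v n. Proof. by []. Qed.

Lemma qshift_starE v n : star qshift v n = (qweight n)%:C * v n.+1.
Proof. exact: wshift_starE. Qed.

Lemma qshift_defectE v n : (1 - qshift * star qshift) v n = (t ^+ n)%:C * v n.
Proof.
rewrite -[LHS]/(v n - qshift (star qshift v) n).
case: n => [|n]; first by rewrite qshift0 subr0 expr0 mul1r.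
by rewrite qshiftS qshift_starE mulrA qweight_sqr rmorphB mulrBl mul1r subKr.
Qed.

(** On coordinate [n] this is [(1 - t^(n+1)) - t (1 - t^n) = 1 - t]; at [n = 0] the second term is 0
    because the shift has no component there. *)
Lemma qshift_rel :
  star qshift * qshift - t%:C *: (qshift * star qshift) = (1 - t)%:C *: 1.
Proof.
apply: bopP => v; apply: l2P => n.
rewrite -[LHS]/(star qshift (qshift v) n - t%:C * qshift (star qshift v) n).
rewrite -[RHS]/((1 - t)%:C * v n) qshift_starE qshiftS mulrA qweight_sqr.
case: n => [|n]; first by rewrite qshift0 mulr0 subr0 expr1.
rewrite qshiftS qshift_starE (mulrA _ _ (v n.+1)) qweight_sqr mulrA -rmorphM.
by rewrite -mulrBl -rmorphB; congr (_%:C * _); rewrite [in LHS]exprS; ring.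
Qed.

Lemma qshift_defect_pow m v n :
  ((1 - qshift * star qshift) ^+ m) v n = (t ^+ (n * m))%:C * v n.
Proof.
elim: m => [|m ih]; first by rewrite muln0 mul1r.
by rewrite exprS bopME qshift_defectE ih mulrA -rmorphM mulnS exprD.
Qed.

Lemma qshift_defect_pow_basis m k :
  ((1 - qshift * star qshift) ^+ m) (l2_basis R k) =
  (t ^+ (k * m))%:C *: l2_basis R k.
Proof.
apply: l2P => n; rewrite qshift_defect_pow l2ZE /=.
by case: eqP => [->|] //; rewrite !mulr0.
Qed.

Lemma qshift_star_pow_coord (mu : int) k l : exists2 w : R[i], w != 0 &
  star_pow qshift mu (l2_basis R k) l = if k%:Z + mu == l then w else 0.
Proof. exact: (wshift_star_pow_coord qweight01 qweight_neq0). Qed.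

End QShift.

(** * Scalars of modulus one as one of the generators *)

Section ScalarUnitary.
Variables (R : realType) (A : starAlgType R) (z : R[i]).
Hypothesis z1 : z * Num.conj z = 1.

Lemma star_scalar (k : R[i]) : star (k%:A : A) = (Num.conj k)%:A.
Proof. by rewrite starZ star1. Qed.

Lemma scalar_unitary : (z%:A : A) * star z%:A = 1.
Proof. by rewrite star_scalar -scalerAl mul1r scalerA z1 scale1r. Qed.

Lemma scalar_unitary' : star z%:A * (z%:A : A) = 1.
Proof. by rewrite star_scalar -scalerAl mul1r scalerA mulrC z1 scale1r. Qed.

Lemma scalar_rel (t : R) :
  star z%:A * z%:A - t%:C *: (z%:A * star z%:A) = (1 - t)%:C *: (1 : A).
Proof. by rewrite scalar_unitary scalar_unitary' rmorphB scalerBl scale1r. Qed.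

(** A scalar is central, and modulus one makes its defect vanish, which settles the last
    relation. *)
Lemma S3pq_rel_shift_scalar (p q : R) (a : A) :
  star a * a - q%:C *: (a * star a) = (1 - q)%:C *: 1 ->
  S3pq_rel p q a z%:A.
Proof.
move=> ra; split=> //; first exact: scalar_rel.
- by rewrite -scalerAr -scalerAl mulr1 mul1r.
- by rewrite -scalerAr -scalerAl mulr1 mul1r.
- by rewrite scalar_unitary subrr mulr0.
Qed.

Lemma S3pq_rel_scalar_shift (p q : R) (b : A) :
  star b * b - p%:C *: (b * star b) = (1 - p)%:C *: 1 ->
  S3pq_rel p q z%:A b.
Proof.
move=> rb; split=> //; first exact: scalar_rel.
- by rewrite -scalerAr -scalerAl mulr1 mul1r.
- by rewrite star_scalar -scalerAr -scalerAl mulr1 mul1r.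
- by rewrite scalar_unitary subrr mul0r.
Qed.

Lemma star_pow_scalar (mu : int) : star_pow (z%:A : A) mu = (z ^ mu)%:A.
Proof.
have z0 : z != 0.
  by apply: contra_eq_neq z1 => ->; rewrite mul0r eq_sym oner_eq0.
(* On the unit circle conjugation is inversion, so negative star powers become negative integer
   powers. *)
have zV : Num.conj z = z^-1 by rewrite -[RHS]mulr1 -z1 mulKf.
have E (k : R[i]) n : (k%:A : A) ^+ n = (k ^+ n)%:A by rewrite exprZn expr1n.
rewrite /star_pow; case: mu => n /=; first exact: E.
by rewrite star_scalar zV E exprVn.
Qed.

End ScalarUnitary.

Lemma star_pow_morph (R : realType) (A B : starAlgType R) (f : {lrmorphism A -> B})
    (x : A) (mu : int) : {morph f : x / star x >-> star x} ->
  f (star_pow x mu) = star_pow (f x) mu.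
Proof. by move=> fs; rewrite /star_pow; case: ifP; rewrite rmorphXn /= ?fs. Qed.

(** * The two circle families of representations on l2 *)

Section Representations.
Variables (R : realType) (p q : R).
Hypotheses (p01 : 0 < p < 1) (q01 : 0 < q < 1).

Lemma S3pq_monomialE (t : S3pq_index) : S3pq_monomial p q t =
  star_pow (gena p q) (val t).1.1 * (1 - gena p q * star (gena p q)) ^+ (val t).2.1 *
  (1 - genb p q * star (genb p q)) ^+ (val t).2.2 * star_pow (genb p q) (val t).1.2.
Proof. by case: t => -[[mu nu] [m n]]. Qed.

Lemma S3pq_rep (a b : l2op R) : S3pq_rel p q a b ->
  exists rho : starRep (OS3pq p q) (l2 R), forall t v,
    rho (S3pq_monomial p q t) v =
    (star_pow a (val t).1.1 * (1 - a * star a) ^+ (val t).2.1 *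
     (1 - b * star b) ^+ (val t).2.2 * star_pow b (val t).1.2) v.
Proof.
move=> /OS3pq_lift_ex [f [fs fa fb]]; have [rho h] := bop_rep_ex fs.
exists rho => t v; rewrite h S3pq_monomialE.
rewrite !rmorphM /= !rmorphXn /= !rmorphB !rmorphM /= !star_pow_morph //.
by rewrite !fs !fa !fb rmorph1.
Qed.

(** The boolean factor is the power [n] of the zero operator [1 - z z^*], equal to 1 for [n = 0].
    The defect of [a] acts before the shift, so its eigenvalue is read at the input index [k]. *)
Lemma rep_shift_scalar (z : R[i]) : z * Num.conj z = 1 ->
  exists rho : starRep (OS3pq p q) (l2 R), forall t k l,
    rho (S3pq_monomial p q t) (l2_basis R k) l =
    ((val t).2.2 == 0%N)%:R * (z ^ (val t).1.2 * (q ^+ (k * (val t).2.1))%:C) *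
       star_pow (qshift q01) (val t).1.1 (l2_basis R k) l.
Proof.
move=> z1; have [rho h] := S3pq_rep (S3pq_rel_shift_scalar z1 p (qshift_rel q01)).
exists rho => t k l; rewrite h.
rewrite scalar_unitary // subrr expr0n star_pow_scalar //.
rewrite -scalerAr mulr1 bopZE l2ZE.
case: eqP => _; last by rewrite mulr0 !mul0r mulr0.
by rewrite mulr1 mul1r bopME qshift_defect_pow_basis bop_scale l2ZE mulrA.
Qed.

(** In a monomial the defect of [b] stands to the left of the power of [b], so here the eigenvalue
    is read at the output index [l]. *)
Lemma rep_scalar_shift (z : R[i]) : z * Num.conj z = 1 ->
  exists rho : starRep (OS3pq p q) (l2 R), forall t k l,
    rho (S3pq_monomial p q t) (l2_basis R k) l =
    ((val t).2.1 == 0%N)%:R * (z ^ (val t).1.1 * (p ^+ (l * (val t).2.2))%:C) *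
       star_pow (qshift p01) (val t).1.2 (l2_basis R k) l.
Proof.
move=> z1; have [rho h] := S3pq_rep (S3pq_rel_scalar_shift z1 q (qshift_rel p01)).
exists rho => t k l; rewrite h.
rewrite scalar_unitary // subrr expr0n star_pow_scalar //.
case: eqP => _; last by rewrite mulr0 !mul0r.
rewrite mulr1 -!(scalerAl _ (_ : l2op R)) !mul1r bopZE l2ZE bopME qshift_defect_pow.
exact: mulrA.
Qed.

End Representations.

(** * Spanning *)

Section Span.
Variables (K : pzRingType) (V : lmodType K) (I : eqType) (f : I -> V).

(** The list is duplicate-free so that such an expression can be passed to [monomial_faithful]. *)
Definition in_span (v : V) := exists (s : seq I) (c : I -> K),
  uniq s /\ v = \sum_(i <- s) c i *: f i.

Lemma in_span0 : in_span 0.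
Proof. by exists [::], (fun=> 0); rewrite big_nil. Qed.

Lemma in_span_gen i : in_span (f i).
Proof. by exists [:: i], (fun=> 1); rewrite big_seq1 scale1r. Qed.

Lemma in_spanZ k v : in_span v -> in_span (k *: v).
Proof.
move=> [s [c [us ->]]]; exists s, (fun i => k * c i); split=> //.
by rewrite scaler_sumr; apply: eq_bigr => i _; rewrite scalerA.
Qed.

Lemma in_spanD u v : in_span u -> in_span v -> in_span (u + v).
Proof.
move=> [s [c [us ->]]] [r [d [ur ->]]].
exists (undup (s ++ r)), (fun i => (if i \in s then c i else 0) +
  (if i \in r then d i else 0)).
split; first exact: undup_uniq.
under [RHS]eq_bigr do rewrite scalerDl.
(* Extending coefficients by zero from [w] to the merged list leaves the sum unchanged. *)
have E (w : seq I) (e : I -> K) : uniq w -> {subset w <= s ++ r} ->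
    \sum_(i <- undup (s ++ r)) (if i \in w then e i else 0) *: f i =
    \sum_(i <- w) e i *: f i.
  move=> uw wsr; rewrite [LHS](bigID (mem w)) /= [X in _ + X]big1 ?addr0; last first.
    by move=> i /negbTE ->; rewrite scale0r.
  rewrite -big_filter; under eq_big_seq => i do
    [rewrite mem_filter => /andP[-> _]].
  apply: perm_big; apply: uniq_perm => //; first by rewrite filter_uniq // undup_uniq.
  move=> i; rewrite mem_filter mem_undup /=; case iw: (i \in w) => //=.
  exact: wsr.
by rewrite big_split /= !E // => i; rewrite mem_cat => ->; rewrite ?orbT.
Qed.

Lemma in_span_sum (J : Type) (s : seq J) (g : J -> V) :
  (forall j, in_span (g j)) -> in_span (\sum_(j <- s) g j).
Proof. by move=> h; elim/big_ind: _ => //; [exact: in_span0|exact: in_spanD]. Qed.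

Lemma in_span_linear (g : V -> V) : linear g -> (forall i, in_span (g (f i))) ->
  forall v, in_span v -> in_span (g v).
Proof.
move=> gl h v [s [c [_ ->]]].
pose G : {linear V -> V} := HB.pack g (GRing.isLinear.Build K V V *:%R g gl).
rewrite -[g]/(G : V -> V) linear_sum; apply: in_span_sum => i.
by rewrite linearZ; exact: in_spanZ.
Qed.

End Span.

(** * Commutation rules for one generator and its defect *)

Section QDisc.
Variables (R : realType) (A : starAlgType R) (t : R) (x : A).
Let X := 1 - x * star x.

Lemma qdisc_mul_star : x * star x = 1 - X.
Proof. by rewrite /X subKr. Qed.

Lemma qdisc_star_defect : star X = X.
Proof. by rewrite /X starB star1 starM starK. Qed.

(** For [mu >= 0] the product is the next power and [d = 0]. For [mu < 0] the factor [x] meets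
    [star x], and [x * star x = 1 - X] gives [d = -1]. *)
Lemma qdisc_step mu : exists d : R[i],
  x * star_pow x mu = (1 + d *: X) * star_pow x (mu + 1).
Proof.
case: mu => n.
  exists 0; rewrite scale0r addr0 mul1r /star_pow /= -exprS.
  by congr (_ ^+ _); lia.
exists (-1); rewrite scaleN1r -qdisc_mul_star -mulrA /star_pow.
have -> : (0 <= Negz n) = false by [].
have -> : `|Negz n|%N = n.+1 by lia.
rewrite exprS; congr (_ * (_ * _)).
by case: n => [|n]; rewrite ?expr0 //; have -> : Negz n.+1 + 1 = Negz n by lia.
Qed.

Hypothesis rel : star x * x - t%:C *: (x * star x) = (1 - t)%:C *: 1.

Lemma qdisc_star_mul : star x * x = 1 - t%:C *: X.
Proof.
rewrite -[LHS](subrK (t%:C *: (x * star x))) rel /X scalerBr rmorphB scalerBl.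
by rewrite scale1r opprB addrA addrAC.
Qed.

(** A correction occurs only for [mu > 0], where [star x * x = 1 - t X] gives [d = -t]. *)
Lemma qdisc_star_step mu : exists d : R[i],
  star x * star_pow x mu = (1 + d *: X) * star_pow x (mu - 1).
Proof.
case: mu => [[|n]|n].
- by exists 0; rewrite scale0r addr0 mul1r /star_pow /= expr0 mulr1 expr1.
- exists (- t%:C); rewrite scaleNr -qdisc_star_mul -mulrA /star_pow.
  have -> : n.+1%:Z - 1 = n by lia.
  by rewrite /= -exprS.
exists 0; rewrite scale0r addr0 mul1r.
have -> : Negz n - 1 = Negz n.+1 by lia.
by rewrite /star_pow /= -exprS.
Qed.

Hypothesis t0 : t%:C != 0 :> R[i].

(** Indeed [X x = x - x (star x x) = x - x (1 - t X)]. *)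
Lemma qdisc_comm : X * x = t%:C *: (x * X).
Proof.
rewrite {1}/X mulrBl mul1r -mulrA qdisc_star_mul mulrBr mulr1 subKr.
by rewrite scalerAr.
Qed.

Lemma qdisc_comm_star : star x * X = t%:C *: (X * star x).
Proof.
have := congr1 star qdisc_comm; rewrite starM starZ starM qdisc_star_defect.
by move=> ->; congr (_ *: _); rewrite -[Num.conj _]/(conjc _) /= oppr0.
Qed.

Lemma qdisc_comm_pow n : x * X ^+ n = (t%:C ^- n) *: (X ^+ n * x).
Proof.
suff -> : X ^+ n * x = (t%:C ^+ n) *: (x * X ^+ n).
  by rewrite scalerA mulVf ?expf_neq0 // scale1r.
elim: n => [|n ih]; first by rewrite !expr0 scale1r mulr1 mul1r.
rewrite exprSr -mulrA qdisc_comm -scalerAr mulrA ih -scalerAl scalerA.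
by rewrite -exprS -mulrA -exprSr.
Qed.

Lemma qdisc_comm_star_pow n : star x * X ^+ n = (t%:C ^+ n) *: (X ^+ n * star x).
Proof.
elim: n => [|n ih]; first by rewrite !expr0 scale1r mulr1 mul1r.
rewrite exprSr mulrA ih -scalerAl -(mulrA _ (star x) X) qdisc_comm_star -scalerAr scalerA.
by rewrite (exprSr t%:C) mulrA.
Qed.

(** Induction on the exponent: each [x] passed contributes a factor [t], each [star x] its
    inverse. *)
Lemma qdisc_comm_star_pow_x mu :
  X * star_pow x mu = (t%:C ^ mu) *: (star_pow x mu * X).
Proof.
rewrite /star_pow; case: mu => n /=.
  rewrite -[t%:C ^ n]/(t%:C ^+ n).
  elim: n => [|n ih]; first by rewrite !expr0 scale1r mulr1 mul1r.
  rewrite exprSr mulrA ih -scalerAl -(mulrA _ X x) qdisc_comm -scalerAr.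
  by rewrite scalerA (exprSr t%:C) mulrA.
rewrite -[t%:C ^ Negz n]/(t%:C ^- n.+1).
elim: n.+1 => [|m ih]; first by rewrite !expr0 invr1 scale1r mulr1 mul1r.
have h : X * star x = t%:C^-1 *: (star x * X).
  by rewrite qdisc_comm_star scalerA mulVf // scale1r.
rewrite exprSr mulrA ih -scalerAl -(mulrA _ X) h -scalerAr scalerA.
by rewrite -invfM (exprSr t%:C) mulrA.
Qed.

End QDisc.

(** * Left multiplication by generators preserves the span of the monomials *)

Section Spanning.
Variables (R : realType) (p q : R).
Hypotheses (p01 : 0 < p < 1) (q01 : 0 < q < 1).

Local Notation a := (gena p q).
Local Notation b := (genb p q).
Local Notation A := (1 - a * star a).
Local Notation B := (1 - b * star b).
Local Notation spanned := (in_span (fun t => S3pq_monomial p q t)).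

Let rel := @OS3pq_rel R p q.

Lemma complex_neq0 (t : R) : 0 < t < 1 -> t%:C != 0 :> R[i].
Proof. by move=> /andP[t0 _]; rewrite fmorph_eq0 gt_eqF. Qed.

Let p0 := complex_neq0 p01.
Let q0 := complex_neq0 q01.

Lemma S3pq_relA : star a * a - q%:C *: (a * star a) = (1 - q)%:C *: 1.
Proof. by case: rel. Qed.

Lemma S3pq_relB : star b * b - p%:C *: (b * star b) = (1 - p)%:C *: 1.
Proof. by case: rel. Qed.

Lemma comm_ba : GRing.comm b a.
Proof. by case: rel. Qed.

Lemma comm_bsa : GRing.comm b (star a).
Proof. by case: rel. Qed.

Lemma comm_sba : GRing.comm (star b) a.
Proof.
have := congr1 star comm_bsa; rewrite !starM starK => h.
by rewrite /GRing.comm h.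
Qed.

Lemma comm_sbsa : GRing.comm (star b) (star a).
Proof. by have := congr1 star comm_ba; rewrite !starM => h; rewrite /GRing.comm h. Qed.

Lemma comm_star_pow_defect (y : OS3pq p q) mu m :
  GRing.comm y a -> GRing.comm y (star a) -> GRing.comm y (star_pow a mu * A ^+ m).
Proof.
move=> ya ysa; apply: commrM.
  by rewrite /star_pow; case: ifP => _; exact: commrX.
by apply: commrX; apply: commrB; [exact: commr1|exact: commrM].
Qed.

(** The exponents [m] and [n] are unconstrained here, so products can be rewritten without tracking
    [m * n = 0]. *)
Definition monomial mu m n nu := star_pow a mu * A ^+ m * B ^+ n * star_pow b nu.

(** If both exponents are positive, the adjacent factors [A * B] are 0 by the last defining
    relation. *)
Lemma monomial_span mu m n nu : spanned (monomial mu m n nu).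
Proof.
have [mn|] := boolP (m * n == 0)%N.
  have := in_span_gen (fun t => S3pq_monomial p q t)
    (exist _ (mu, nu, (m, n)) mn : S3pq_index).
  by rewrite S3pq_monomialE.
rewrite muln_eq0 negb_or /monomial; case: m n => [|m] [|n] // _.
have r0 : A * B = 0 by case: rel.
rewrite exprSr exprS -!mulrA (mulrA A B) r0 mul0r !mulr0.
exact: in_span0.
Qed.

(** [a] raises [mu] by one at the cost of a factor [1 + d A]; the [A] moves past the power of [a] up
    to a scalar and joins [A ^+ m]. *)
Lemma span_mul_monomial_a mu m n nu : spanned (a * monomial mu m n nu).
Proof.
have [d h] := qdisc_step a mu.
rewrite /monomial !mulrA h mulrDl mul1r -scalerAl (qdisc_comm_star_pow_x S3pq_relA q0).
rewrite scalerA !mulrDl -!scalerAl -(mulrA _ A (A ^+ m)) -exprS.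
by apply: in_spanD; [|apply: in_spanZ]; exact: monomial_span.
Qed.

Lemma span_mul_monomial_sa mu m n nu : spanned (star a * monomial mu m n nu).
Proof.
have [d h] := qdisc_star_step S3pq_relA mu.
rewrite /monomial !mulrA h mulrDl mul1r -scalerAl (qdisc_comm_star_pow_x S3pq_relA q0).
rewrite scalerA !mulrDl -!scalerAl -(mulrA _ A (A ^+ m)) -exprS.
by apply: in_spanD; [|apply: in_spanZ]; exact: monomial_span.
Qed.

(** [b] commutes with the part in [a] and [star a], passes [B ^+ n] up to a power of [p], and then
    raises [nu]; the correction [d B] joins [B ^+ n]. *)
Lemma span_mul_monomial_b mu m n nu : spanned (b * monomial mu m n nu).
Proof.
have [d h] := qdisc_step b nu.
have c := comm_star_pow_defect mu m comm_ba comm_bsa.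
rewrite /monomial -!mulrA (mulrA (star_pow a mu)) (mulrA b) c.
rewrite -(mulrA _ b) (mulrA b (B ^+ n)) (qdisc_comm_pow S3pq_relB p0).
rewrite -scalerAl -(mulrA (B ^+ n)) h mulrDl mul1r mulrDr -!scalerAl -!scalerAr.
rewrite mulrDr -scalerAr (mulrA (B ^+ n) B) -exprSr !mulrA.
apply: in_spanZ; apply: in_spanD; [|apply: in_spanZ]; exact: monomial_span.
Qed.

Lemma span_mul_monomial_sb mu m n nu : spanned (star b * monomial mu m n nu).
Proof.
have [d h] := qdisc_star_step S3pq_relB nu.
have c := comm_star_pow_defect mu m comm_sba comm_sbsa.
rewrite /monomial -!mulrA (mulrA (star_pow a mu)) (mulrA (star b)) c.
rewrite -(mulrA _ (star b)) (mulrA (star b) (B ^+ n)) (qdisc_comm_star_pow S3pq_relB).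
rewrite -scalerAl -(mulrA (B ^+ n)) h mulrDl mul1r mulrDr -!scalerAl -!scalerAr.
rewrite mulrDr -scalerAr (mulrA (B ^+ n) B) -exprSr !mulrA.
apply: in_spanZ; apply: in_spanD; [|apply: in_spanZ]; exact: monomial_span.
Qed.

Lemma span_mul (x : OS3pq p q) :
  (forall mu m n nu, spanned (x * monomial mu m n nu)) ->
  forall v, spanned v -> spanned (x * v).
Proof.
move=> h v; apply: (in_span_linear (g := fun y => x * y)) => [k y z|t].
  by rewrite mulrDr -scalerAr.
by rewrite S3pq_monomialE; exact: h.
Qed.

(** Induction on a term representing [x], showing that left multiplication by [x] and by [star x]
    both preserve the span. Carrying both makes the star case a swap. Applying the result to 1,
    itself a monomial, gives the claim. *)
Lemma OS3pq_span (x : OS3pq p q) : spanned x.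
Proof.
suff h : (forall v, spanned v -> spanned (x * v)) /\
         (forall v, spanned v -> spanned (star x * v)).
  have : spanned (monomial 0 0 0 0) by exact: monomial_span.
  rewrite /monomial /star_pow /= !expr0 !mulr1 => /h.1.
  by rewrite mulr1.
elim/pquotW: x => t; rewrite -seval_gen; elim: t => /=.
- split; apply: span_mul => mu m n nu.
    exact: span_mul_monomial_a.
  exact: span_mul_monomial_sa.
- split; apply: span_mul => mu m n nu.
    exact: span_mul_monomial_b.
  exact: span_mul_monomial_sb.
- by rewrite star0; split=> v _; rewrite mul0r; exact: in_span0.
- by rewrite star1; split=> v; rewrite mul1r.
- move=> x [hx hx'] y [hy hy']; rewrite starD.
  by split=> v hv; rewrite mulrDl; apply: in_spanD; auto.
- move=> x [hx hx']; rewrite starN.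
  by split=> v hv; rewrite mulNr -scaleN1r; apply: in_spanZ; auto.
- move=> x [hx hx'] y [hy hy']; rewrite starM.
  by split=> v hv; rewrite -mulrA; auto.
- move=> k x [hx hx']; rewrite starZ.
  by split=> v hv; rewrite -scalerAl; apply: in_spanZ; auto.
- by move=> x [hx hx']; rewrite starK.
Qed.

End Spanning.

(** * Linear independence and faithfulness *)

Section Coefficients.

Lemma poly_inf_roots (F : idomainType) (P : {poly F}) (g : nat -> F) :
  injective g -> (forall j, P.[g j] = 0) -> P = 0.
Proof.
move=> gi gP; apply/eqP/negP => /negP P0.
have := @max_poly_roots _ P (map g (iota 0 (size P))) P0.
rewrite size_map size_iota ltnn map_inj_uniq // iota_uniq => /(_ _ isT).
suff -> : all (root P) [seq g i | i <- iota 0 (size P)] by move=> /(_ isT).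
by apply/allP => _ /mapP[j _ ->]; rewrite /root gP.
Qed.

(** The sum is a polynomial evaluated at the infinitely many points [g j], so it is the zero
    polynomial; several [t] may share an exponent, hence the grouped coefficient. *)
Lemma coef_vanish (F : idomainType) (T : eqType) (s : seq T) (P : pred T)
    (c : T -> F) (e : T -> nat) (g : nat -> F) : injective g ->
  (forall j, \sum_(t <- s | P t) c t * g j ^+ e t = 0) ->
  forall e0, \sum_(t <- s | P t && (e t == e0)) c t = 0.
Proof.
move=> gi h e0.
have Q0 : \sum_(t <- s | P t) c t *: 'X^(e t) = 0.
  apply: (poly_inf_roots gi) => j; rewrite horner_sum -[RHS](h j).
  by apply: eq_bigr => t _; rewrite hornerZ hornerXn.
have := congr1 (fun Q : {poly F} => Q`_e0) Q0; rewrite coef_sum coef0 => h0.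
rewrite -[RHS]h0 big_mkcondr; apply: eq_bigr => t _.
by rewrite coefZ coefXn eq_sym; case: eqP; rewrite ?mulr1 ?mulr0.
Qed.

Variable R : realType.

(** A Cayley transform: a number over its conjugate has modulus one. It yields infinitely many
    distinct points of the circle without trigonometry. *)
Definition circle_pt n : R[i] := (n%:R +i* 1) / (n%:R -i* 1).

Lemma circle_pt_neq0 (x e : R) : e != 0 -> x +i* e != 0.
Proof. by move=> e0; apply: contra e0; rewrite eq_complex => /andP[]. Qed.

Lemma circle_pt_unitary n : circle_pt n * Num.conj (circle_pt n) = 1.
Proof.
rewrite /circle_pt rmorphM fmorphV.
have E (x y : R) : Num.conj (x +i* y) = x -i* y by [].
rewrite /= !E opprK.
have h1 : n%:R +i* 1 != 0 :> R[i] by rewrite circle_pt_neq0 ?oner_eq0.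
have h2 : n%:R -i* 1 != 0 :> R[i] by rewrite circle_pt_neq0 ?oppr_eq0 ?oner_eq0.
by rewrite mulrA divfK // mulfV.
Qed.

Lemma circle_pt_inj : injective circle_pt.
Proof.
move=> m n /eqP; rewrite /circle_pt eqr_div ?circle_pt_neq0 ?oppr_eq0 ?oner_eq0 //.
(* After cross-multiplication the imaginary parts read [n - m = m - n]. *)
rewrite eq_complex /= => /andP[_ /eqP h].
by apply/eqP; rewrite -(eqr_nat R); apply/eqP; lra.
Qed.

Lemma pow_inj (r : R) K : 0 < r < 1 ->
  injective (fun j => (r ^+ (K + j)%N)%:C : R[i]).
Proof.
move=> /andP[r0 r1] i j /complexI /(ieexprIn r0 (negbT (lt_eqF r1))).
exact: addnI.
Qed.

(** Two coefficient extractions: for fixed [k] the sum is a Laurent polynomial in [z], and its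
    coefficient at [nu0] is a polynomial in [r^k]. *)
Lemma laurent_coef_vanish (T : eqType) (s : seq T) (P : pred T) (c : T -> R[i])
    (nu : T -> int) (m : T -> nat) (r : R) (K : nat) : 0 < r < 1 ->
  (forall z : R[i], z * Num.conj z = 1 -> forall k, (K <= k)%N ->
    \sum_(t <- s | P t) c t * (z ^ nu t * (r ^+ (k * m t))%:C) = 0) ->
  forall nu0 m0, \sum_(t <- s | P t && (nu t == nu0) && (m t == m0)) c t = 0.
Proof.
move=> r01 h nu0 m0.
(* [N] bounds every [nu t] and [nu0] in absolute value, so multiplying by [z^N] clears the negative
   powers. *)
pose N := (\sum_(t <- s) `|nu t| + `|nu0|)%N.
have Nnu t : t \in s -> (0 <= N%:Z + nu t).
  by move=> ts; have : (`|nu t| <= N)%N; [rewrite /N (big_rem t ts) /= | ]; lia.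
have Nnu0 : 0 <= N%:Z + nu0 by rewrite /N; lia.
(* The outer extraction, at the distinct points [r^(K + j)]; the inner one over the circle provides
   its hypothesis. *)
apply: (coef_vanish (P := fun t => P t && (nu t == nu0)) (pow_inj (K := K) r01)) => j.
set k := (K + j)%N.
have h1 i : \sum_(t <- s | P t) (c t * (r ^+ (k * m t))%:C) *
    circle_pt i ^+ `|N%:Z + nu t| = 0.
  have z1 := circle_pt_unitary i.
  have z0 : circle_pt i != 0.
    by apply: contra_eq_neq z1 => ->; rewrite mul0r eq_sym oner_eq0.
  transitivity (circle_pt i ^ N%:Z * \sum_(t <- s | P t)
      c t * (circle_pt i ^ nu t * (r ^+ (k * m t))%:C)); last first.
    by rewrite (h _ z1 k (leq_addr _ _)) mulr0.
  rewrite mulr_sumr [LHS]big_seq_cond [RHS]big_seq_cond.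
  apply: eq_bigr => t /andP[ts _].
  rewrite [in LHS](_ : circle_pt i ^+ _ = circle_pt i ^ (N%:Z + nu t)).
    by rewrite expfzDr // mulrCA !mulrA mulrAC.
  by rewrite exprnP gez0_abs // Nnu.
have h2 := coef_vanish circle_pt_inj h1 (absz (N%:Z + nu0)).
rewrite -[RHS]h2 [LHS]big_seq_cond [RHS]big_seq_cond; apply: eq_big => t; last first.
  by move=> _; rewrite -rmorphXn -exprM.
case ts : (t \in s) => //=; congr (_ && _).
by have := Nnu t ts; move=> ?; apply/eqP/eqP; lia.
Qed.

End Coefficients.

Lemma addz_abszD (k : nat) (mu mu0 : int) : (`|mu0| <= k)%N ->
  (k%:Z + mu == `|(k%:Z + mu0)%R|%N) = (mu == mu0).
Proof. by move=> h; apply/eqP/eqP; lia. Qed.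

Lemma absz_subzD (l : nat) (mu mu0 : int) : (`|mu0| <= l)%N ->
  (`|(l%:Z - mu0)%R|%N%:Z + mu == l) = (mu == mu0).
Proof. by move=> h; apply/eqP/eqP; lia. Qed.

(** * Recovering coefficients from the representations on l2 *)

Section Faithfulness.
Variables (R : realType) (p q : R).
Hypotheses (p01 : 0 < p < 1) (q01 : 0 < q < 1).

Lemma rep_sum (A : starAlgType R) (H : hilbertType R) (rho : starRep A H)
    (T : Type) (s : seq T) (c : T -> R[i]) (f : T -> A) v :
  rho (\sum_(t <- s) c t *: f t) v = \sum_(t <- s) c t *: rho (f t) v.
Proof.
elim: s => [|t s ih]; last by rewrite !big_cons repD repZ ih.
by rewrite !big_nil -(scale0r (0 : A)) repZ scale0r.
Qed.

Lemma l2_sumE (T : Type) (s : seq T) (c : T -> R[i]) (f : T -> l2 R) l :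
  (\sum_(t <- s) c t *: f t) l = \sum_(t <- s) c t * f t l.
Proof.
by elim: s => [|t s ih]; rewrite ?big_nil // !big_cons l2DE l2ZE ih.
Qed.

Lemma monomial_faithful (s : seq S3pq_index) (c : S3pq_index -> R[i]) : uniq s ->
  (forall (rho : starRep (OS3pq p q) (l2 R)) v,
    rho (\sum_(t <- s) c t *: S3pq_monomial p q t) v = 0) ->
  forall t, t \in s -> c t = 0.
Proof.
move=> us h t0 t0s.
(* Since [s] is duplicate-free, a selection that singles out [t0] leaves just its coefficient. *)
have finish (P : pred S3pq_index) : (forall t, P t = (t == t0)) ->
    \sum_(t <- s | P t) c t = 0 -> c t0 = 0.
  by move=> Pt; rewrite (eq_bigl _ _ Pt) -big_filter filter_pred1_uniq // big_seq1.
have val_eq (t : S3pq_index) : (t == t0) = (val t == val t0) by [].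
(* The first family detects monomials with [n = 0]; those with [n > 0] have [m = 0] and are left to
   the second. *)
have [n0|n0] := eqVneq (val t0).2.2 0%N.
  have key (z : R[i]) : z * Num.conj z = 1 -> forall k, (`|(val t0).1.1| <= k)%N ->
      \sum_(t <- s | ((val t).2.2 == 0%N) && ((val t).1.1 == (val t0).1.1))
        c t * (z ^ (val t).1.2 * (q ^+ (k * (val t).2.1))%:C) = 0.
    move=> z1 k hk; have [rho hrho] := rep_shift_scalar p q01 z1.
    (* The bound on [k] makes [k + mu0] nonnegative, so [l] equals it and only terms with [mu = mu0]
       reach coordinate [l]. *)
    pose l := absz (k%:Z + (val t0).1.1).
    have [w w0 hw] := qshift_star_pow_coord q01 (val t0).1.1 k l.
    have := congr1 (fun u : l2 R => u l) (h rho (l2_basis R k)).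
    (* The weight [w] depends only on [mu0], [k] and [l], so it is common to all surviving terms and
       can be cancelled. *)
    rewrite rep_sum l2_sumE l20E => h0; apply: (mulIf w0); rewrite mul0r -[RHS]h0.
    rewrite big_mkcond mulr_suml; apply: eq_bigr => t _; rewrite hrho.
    case: eqP => _; rewrite ?andTb ?andFb; last by rewrite !mul0r mulr0.
    case: (eqVneq _ _) => [->|ne].
      by rewrite hw addz_abszD // eqxx mul1r [RHS]mulrA.
    have [w' _ ->] := qshift_star_pow_coord q01 (val t).1.1 k l.
    by rewrite addz_abszD // (negbTE ne) !mulr0 mul0r.
  apply: finish (laurent_coef_vanish q01 key (val t0).1.2 (val t0).2.1).
  move=> t; rewrite val_eq; case: t => -[[mu nu] [m n]] mn.
  case: t0 n0 {h t0s val_eq key} => -[[mu0 nu0] [m0 n0]] mn0 /= ->.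
  by rewrite !xpair_eqE; case: (mu == mu0); case: (nu == nu0);
    case: (m == m0); case: (n == 0%N).
have m0 : (val t0).2.1 = 0%N.
  by apply/eqP; have := valP t0; rewrite muln_eq0 (negbTE n0) orbF.
have key (z : R[i]) : z * Num.conj z = 1 -> forall l, (`|(val t0).1.2| <= l)%N ->
    \sum_(t <- s | ((val t).2.1 == 0%N) && ((val t).1.2 == (val t0).1.2))
      c t * (z ^ (val t).1.1 * (p ^+ (l * (val t).2.2))%:C) = 0.
  move=> z1 l hl; have [rho hrho] := rep_scalar_shift q p01 z1.
  (* Now [l] is the free large index, because the power of [p] is read there; [k = l - nu0] is the
     matching input. *)
  pose k := absz (l%:Z - (val t0).1.2).
  have [w w0 hw] := qshift_star_pow_coord p01 (val t0).1.2 k l.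
  have := congr1 (fun u : l2 R => u l) (h rho (l2_basis R k)).
  rewrite rep_sum l2_sumE l20E => h0; apply: (mulIf w0); rewrite mul0r -[RHS]h0.
  rewrite big_mkcond mulr_suml; apply: eq_bigr => t _; rewrite hrho.
  case: eqP => _; rewrite ?andTb ?andFb; last by rewrite !mul0r mulr0.
  case: (eqVneq _ _) => [->|ne].
    by rewrite hw absz_subzD // eqxx mul1r [RHS]mulrA.
  have [w' _ ->] := qshift_star_pow_coord p01 (val t).1.2 k l.
  by rewrite absz_subzD // (negbTE ne) !mulr0 mul0r.
apply: finish (laurent_coef_vanish p01 key (val t0).1.1 (val t0).2.2).
move=> t; rewrite val_eq; case: t => -[[mu nu] [m n]] mn.
case: t0 m0 {h t0s val_eq key n0} => -[[mu0 nu0] [m0 n0]] mn0 /= ->.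
by rewrite !xpair_eqE; case: (mu == mu0); case: (nu == nu0);
  case: (m == 0%N); case: (n == n0).
Qed.

Lemma monomial_indep : lin_indep (fun t : S3pq_index => S3pq_monomial p q t).
Proof.
move=> s c us s0; apply: monomial_faithful us _ => rho v.
by rewrite s0 -(scale0r (0 : OS3pq p q)) repZ scale0r.
Qed.

Lemma cnorm0 (A : cstarAlgType R) : cnorm (0 : A) = 0.
Proof. by apply: complexI; rewrite -(scale0r (0 : A)) cnormZ normr0 mul0r. Qed.

Lemma rep_norm0_rep (x : OS3pq p q) : rep_norm x = 0 ->
  forall (H : hilbertType R) (rho : starRep (OS3pq p q) H) v, rho x v = 0.
Proof.
move=> x0 H rho v.
have n0 : opnorm (rho x) <= 0.
  by rewrite -x0; exact: rep_norm_ub (OS3pq_rep_bounded p01 q01) _ _ rho.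
apply: hnorm_eq0; apply/eqP; rewrite eq_le hnorm_ge0 andbT.
apply: le_trans (opnormP (rep_bounded rho x) v) _.
by rewrite mulr_le0_ge0 ?hnorm_ge0.
Qed.

End Faithfulness.

Theorem theorem2p3 (R : realType) (p q : R)
    (hp : 0 < p < 1) (hq : 0 < q < 1) :
  vs_basis (fun t : S3pq_index => S3pq_monomial p q t) /\
  injective (OS3pq_to_CS3pq hp hq).
Proof.
split; first split.
- exact: monomial_indep.
- by move=> v; have [s [c [_ ->]]] := OS3pq_span hp hq v; exists s, c.
move=> x y xy; apply/eqP; rewrite -subr_eq0; apply/eqP.
(* The completion norm restricts to the enveloping seminorm, so equal images force the difference to
   have seminorm zero. *)
have d0 : rep_norm (x - y) = 0.
  by rewrite -(OS3pq_to_CS3pq_norm hp hq) raddfB /= xy subrr cnorm0.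
have [s [c [us E]]] := OS3pq_span hp hq (x - y).
(* Seminorm zero means that every representation kills [x - y], in particular those on l2 that
   determine the coefficients. *)
have c0 : forall t, t \in s -> c t = 0.
  apply: (monomial_faithful hp hq us) => rho v; rewrite -E.
  exact: rep_norm0_rep d0 _ rho v.
by rewrite E big_seq big1 // => t /c0 ->; rewrite scale0r.
Qed.
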